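(* Let $N\ge2$, let $\mu_1<\cdots<\mu_K<0$ be the distinct spectral values with multiplicities $k_1,\dots,k_K\ge1$, $k_1+\cdots+k_K=N$, and let $I_\alpha$ and $\nu_1,\dots,\nu_N$ be as defined in the context. Let $u=(u_1,\dots,u_N)\in H^1(\mathbb{R})^N$ be a solution of $$u_i''+2\Big(\sum_{j=1}^Nu_j^2\Big)u_i+\nu_iu_i=0\quad\text{in }\mathbb{R},\qquad i=1,\dots,N,$$ such that $\sum_{i\in I_\alpha}u_i^2\not\equiv0$ for every $\alpha=1,\dots,K$. Then for every $\alpha=1,\dots,K$, $$\int_{\mathbb{R}}\sum_{i\in I_\alpha}u_i^2(x)\,dx=2\sqrt{|\mu_\alpha|}>0.$$
   Context: All functions are real-valued; equations for $H^1$ functions are understood in the distributional sense. Blocks and repeated parameters: $N_0:=0$, $N_\alpha:=k_1+\cdots+k_\alpha$, $I_\alpha:=\{N_{\alpha-1}+1,\dots,N_\alpha\}$ for $\alpha=1,\dots,K$, and $\nu_i:=\mu_\alpha$ for $i\in I_\alpha$. *)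

(* Defs.v *)
From mathcomp Require Import all_boot all_order all_algebra.
From mathcomp Require Import all_classical all_reals all_analysis.

Set Implicit Arguments.
Unset Strict Implicit.
Unset Printing Implicit Defensive.

Import Order.TTheory GRing.Theory Num.Theory.
Import numFieldNormedType.Exports.

Local Open Scope ring_scope.

(* C^oo with compact support. *)
Definition test_function (R : realType) (phi : R -> R) : Prop :=
  (forall (n : nat) (x : R), derivable (derive1n n phi) x 1) /\
  compact (closure [set x : R | phi x != 0]%classic).

(* The regular distribution f |-> (phi |-> \int f phi). It is meaningful for
   locally integrable f only, since Rintegral returns a default value when the
   integral diverges; it is applied below to L^2 functions and to polynomial
   expressions, without constant term, in H^1 functions (H^1(R) being included
   in L^2 and in L^oo, these are locally integrable). *)
Definition distr (R : realType) (f phi : R -> R) : R :=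
  Rintegral (@lebesgue_measure R) setT (fun x => f x * phi x).

Definition distr_deriv (R : realType) (n : nat) (T : (R -> R) -> R)
    (phi : R -> R) : R :=
  (-1) ^+ n * T (derive1n n phi).

(* Elements of H^1(R) are given by Borel representatives of their classes. *)
Definition H1 (R : realType) (f : R -> R) : Prop :=
  f \in Lfun (@lebesgue_measure R) 2%:E /\
  exists2 g : R -> R, g \in Lfun (@lebesgue_measure R) 2%:E &
    forall phi, test_function phi ->
      distr_deriv 1 (distr f) phi = distr g phi.

(* u_i'' + 2 (\sum_j u_j^2) u_i + nu_i u_i = 0 as distributions. *)
Definition system_solution (R : realType) (N : nat) (nu : 'I_N -> R)
    (u : 'I_N -> R -> R) : Prop :=
  forall (i : 'I_N) (phi : R -> R), test_function phi ->
    distr_deriv 2 (distr (u i)) phi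
    + distr (fun x => 2 * (\sum_(j < N) u j x ^+ 2) * u i x) phi
    + distr (fun x => nu i * u i x) phi = 0.

(* Indices start at 0: the blocks k_0, ..., k_(K-1) partition 'I_N, for
   N = \sum_a k_a, into consecutive intervals. *)
Definition offset (K : nat) (k : 'I_K -> nat) (n : nat) : nat :=
  (\sum_(b < K | b < n) k b)%N.

Definition block (N K : nat) (k : 'I_K -> nat) (a : 'I_K) : {set 'I_N} :=
  [set i : 'I_N | (offset k a <= i < offset k a.+1)%N]%SET.

(* Main.v *)
Require Import Defs.
From mathcomp Require Import all_boot all_order all_algebra.
From mathcomp Require Import all_classical all_reals all_analysis.
From mathcomp Require Import measurable_realfun.
From mathcomp Require Import ring lra.

Set Implicit Arguments.
Unset Strict Implicit.
Unset Printing Implicit Defensive.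

Import Order.TTheory GRing.Theory Num.Theory.
Import numFieldNormedType.Exports.

Local Open Scope ring_scope.

(** The idea: Darboux transformations remove the spectral values one by one, from
    the lowest up. Elements of H^1 solving the system have C^2 representatives
    which decay at infinity together with their first derivatives. Let nu be the
    lowest spectral value, attained by u_0, put V = \sum_j u_j^2, and let
    W_j = u_0 u_j' - u_j u_0'. The quantity
      u_0'^2 + nu u_0^2 + u_0^2 V + \sum_j W_j^2 / (nu_j - nu)
    is constant, hence zero. It follows that u_0 has no zero, that q = u_0' / u_0
    tends to -+ sqrt(-nu) at +-oo, and that the functions
    w_j = (u_j' - q u_j) / sqrt(nu_j - nu), for nu_j > nu, solve the same system
    with the lowest block removed. Moreover q' = \sum_j w_j^2 - V, while
    w_j^2 - u_j^2 is the derivative of a function which decays at infinity.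
    Hence the masses of the remaining blocks do not change and the mass of the
    removed block is the total variation 2 sqrt(-nu) of - q. *)

(** * Derivatives and decay at infinity *)

(** The lowest value has to go first because of signs: all terms of the first integral except nu
    u_0^2 are then nonnegative, so |u_0'| <= sqrt(-nu) |u_0| and a single zero of u_0 would spread
    to the whole line. Divided by u_0^2, the first integral gives only the limit of q^2; the signs
    at the two ends need a separate convexity argument. A multiple value costs nothing: components
    sharing nu have zero Wronskian with u_0, so the operator d/dx - q kills them all at once, and
    the mass of the block does not see its multiplicity. Single components may vanish identically,
    hence the induction runs over sets of components, not over blocks. The other obstacle is that
    the hypotheses concern only classes of functions and test functions. Smooth bumps are therefore
    built by hand, in order to show that a function with a locally integrable weak derivative is
    almost everywhere a primitive of it. Decay at infinity then comes from an energy: the integrals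
    of u_i^2 and u_i'^2 are bounded and control the oscillation of these functions. *)

Section derivatives.
Context {R : realType}.
Implicit Types f g : R -> R.

Definition is_deriv f f' := forall x : R, is_derive x (1 : R) f (f' x).

Lemma is_deriv_eq f f' g' : is_deriv f f' -> f' =1 g' -> is_deriv f g'.
Proof. by move=> ff' e x; rewrite -e. Qed.

Lemma is_deriv_cst (c : R) : is_deriv (fun=> c) (fun=> 0).
Proof. by move=> x; exact: is_derive_cst. Qed.

Lemma is_derivN f f' : is_deriv f f' -> is_deriv (fun x => - f x) (fun x => - f' x).
Proof. by move=> ff' x; exact: is_deriveN. Qed.

Lemma is_derivD f f' g g' : is_deriv f f' -> is_deriv g g' ->
  is_deriv (fun x => f x + g x) (fun x => f' x + g' x).
Proof. by move=> ff' gg' x; exact: is_deriveD. Qed.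

Lemma is_derivM f f' g g' : is_deriv f f' -> is_deriv g g' ->
  is_deriv (fun x => f x * g x) (fun x => f' x * g x + f x * g' x).
Proof.
move=> ff' gg' x; apply: is_derive_eq; first exact: is_deriveM.
by rewrite addrC /GRing.scale/= [g x * _]mulrC.
Qed.

Lemma is_derivB f f' g g' : is_deriv f f' -> is_deriv g g' ->
  is_deriv (fun x => f x - g x) (fun x => f' x - g' x).
Proof. by move=> ff' gg'; apply: is_derivD => //; exact: is_derivN. Qed.

Lemma is_derivMl (c : R) f f' : is_deriv f f' ->
  is_deriv (fun x => c * f x) (fun x => c * f' x).
Proof.
move=> ff'; apply: is_deriv_eq (is_derivM (is_deriv_cst c) ff') _ => x /=.
by rewrite mul0r add0r.
Qed.

Lemma is_deriv_sqr f f' : is_deriv f f' ->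
  is_deriv (fun x => f x ^+ 2) (fun x => 2 * f x * f' x).
Proof.
move=> ff'; apply: is_deriv_eq (is_derivM ff' ff') _ => x /=; ring.
Qed.

Lemma is_derivV f f' : (forall x, f x != 0) -> is_deriv f f' ->
  is_deriv (fun x => (f x)^-1) (fun x => - f' x / f x ^+ 2).
Proof.
move=> f0 ff' x; apply: is_derive_eq; first exact: is_deriveV.
by rewrite /GRing.scale/= mulrC mulrN mulNr.
Qed.

Lemma is_deriv_sum (I : finType) (P : pred I) (F F' : I -> R -> R) :
  (forall i, P i -> is_deriv (F i) (F' i)) ->
  is_deriv (fun x => \sum_(i | P i) F i x) (fun x => \sum_(i | P i) F' i x).
Proof.
move=> FF'.
have aux (s : seq I) : is_deriv (fun x => \sum_(i <- s | P i) F i x)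
    (fun x => \sum_(i <- s | P i) F' i x).
  elim: s => [|i s IH].
    rewrite (_ : (fun x => _) = fun=> 0); last by apply/funext => x; rewrite big_nil.
    by apply: is_deriv_eq; [exact: is_deriv_cst|move=> x; rewrite big_nil].
  have [Pi|Pi] := boolP (P i).
    rewrite (_ : (fun x => _) = (fun x => F i x + \sum_(i <- s | P i) F i x)).
      apply: is_deriv_eq; first by apply: is_derivD IH; exact: FF'.
      by move=> x; rewrite big_cons Pi.
    by apply/funext => x; rewrite big_cons Pi.
  rewrite (_ : (fun x => _) = (fun x => \sum_(i <- s | P i) F i x)).
    by apply: is_deriv_eq IH _ => x; rewrite big_cons (negbTE Pi).
  by apply/funext => x; rewrite big_cons (negbTE Pi).
exact: aux.
Qed.

Lemma is_deriv_comp f f' g g' : is_deriv f f' -> is_deriv g g' ->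
  is_deriv (fun x => g (f x)) (fun x => f' x * g' (f x)).
Proof.
move=> ff' gg' x; rewrite mulrC.
exact: (@is_derive1_comp _ g f x _ _ (gg' _) (ff' _)).
Qed.

Lemma is_deriv_affine (c d : R) f f' : is_deriv f f' ->
  is_deriv (fun x => f (c * x + d)) (fun x => c * f' (c * x + d)).
Proof.
move=> ff'; apply: (@is_deriv_comp (fun x => c * x + d) (fun=> c)) ff'.
apply: is_deriv_eq.
  apply: is_derivD; last exact: is_deriv_cst.
  by apply: is_derivMl => x; exact: is_derive_id.
by move=> x /=; rewrite mulr1 addr0.
Qed.

Lemma is_deriv_opp f f' : is_deriv f f' ->
  is_deriv (fun x => f (- x)) (fun x => - f' (- x)).
Proof.
move=> /(is_deriv_affine (-1) 0); under eq_fun do rewrite mulN1r addr0.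
by move=> h; apply: is_deriv_eq h _ => x; rewrite mulN1r addr0 mulN1r.
Qed.

Lemma is_deriv_continuous f f' : is_deriv f f' -> continuous f.
Proof.
move=> ff' x; apply: differentiable_continuous; apply/derivable1_diffP.
by have [] := ff' x.
Qed.

Lemma is_deriv_is_cst f : is_deriv f (fun=> 0) -> forall x y, f x = f y.
Proof. by move=> f0 x y; exact: is_derive_0_is_cst. Qed.

Lemma is_deriv_MVT f f' (a b : R) : is_deriv f f' -> a <= b ->
  exists2 c, a <= c <= b & f b - f a = f' c * (b - a).
Proof.
move=> ff' ab; have [|c cab ->] := MVT_segment ab (fun x _ => ff' x).
  by apply: continuous_subspaceT; exact: is_deriv_continuous ff'.
by exists c.
Qed.

Lemma is_deriv_ndecr f f' (a b : R) : is_deriv f f' ->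
  (forall x, a <= x <= b -> 0 <= f' x) -> a <= b -> f a <= f b.
Proof.
move=> ff' f'0 ab; have [c cab] := is_deriv_MVT ff' ab.
by move=> fab; rewrite -subr_ge0 fab mulr_ge0 ?subr_ge0// f'0.
Qed.

Lemma is_deriv_nincr f f' (a b : R) : is_deriv f f' ->
  (forall x, a <= x <= b -> f' x <= 0) -> a <= b -> f b <= f a.
Proof.
move=> ff' f'0 ab; rewrite -lerN2; apply: (is_deriv_ndecr (is_derivN ff')) => //.
by move=> x xab; rewrite oppr_ge0 f'0.
Qed.

End derivatives.

Section decay.
Local Open Scope classical_set_scope.
Local Open Scope ring_scope.
Context {R : realType}.
Implicit Types f g : R -> R.

Definition decays f := f x @[x --> +oo] --> (0 : R) /\ f x @[x --> -oo] --> (0 : R).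

Lemma decays_is_cst0 f : (forall x y, f x = f y) -> decays f -> forall x, f x = 0.
Proof.
move=> fc [+ _] x; rewrite (_ : f = fun=> f x); last by apply/funext => y; exact: fc.
by move/(cvg_unique _ (cvg_cst (f x))) => /(_ (@Rhausdorff R)).
Qed.

Lemma decaysD f g : decays f -> decays g -> decays (fun x => f x + g x).
Proof.
by move=> [f1 f2] [g1 g2]; split; rewrite -[0 in X in _ --> X]addr0; exact: cvgD.
Qed.

Lemma decaysN f : decays f -> decays (fun x => - f x).
Proof.
by move=> [f1 f2]; split; rewrite -[0 in X in _ --> X]oppr0; exact: cvgN.
Qed.

Lemma decaysB f g : decays f -> decays g -> decays (fun x => f x - g x).
Proof. by move=> df dg; apply: decaysD => //; exact: decaysN. Qed.

Lemma decaysM f g : decays f -> decays g -> decays (fun x => f x * g x).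
Proof.
by move=> [f1 f2] [g1 g2]; split; rewrite -[0 in X in _ --> X](mulr0 0); exact: cvgM.
Qed.

Lemma decaysMl (c : R) f : decays f -> decays (fun x => c * f x).
Proof.
move=> [f1 f2].
by split; rewrite -[0 in X in _ --> X](mulr0 c); apply: cvgM => //; exact: cvg_cst.
Qed.

Lemma decays_sqr f : decays f -> decays (fun x => f x ^+ 2).
Proof. by move=> df; under eq_fun do rewrite expr2; exact: decaysM. Qed.

Lemma decays_sum (I : finType) (P : pred I) (F : I -> R -> R) :
  (forall i, P i -> decays (F i)) -> decays (fun x => \sum_(i | P i) F i x).
Proof.
move=> dF; rewrite (_ : (fun x => _) = \sum_(i | P i) F i); last first.
  by apply/funext => x; rewrite fct_sumE.
apply: big_ind dF => [|f g]; last exact: decaysD.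
by split; exact: cvg_cst.
Qed.

Lemma decays_le f g : (forall x, `|f x| <= g x) -> decays g -> decays f.
Proof.
move=> fg [g1 g2]; split; (apply/norm_cvg0P; apply: (@squeeze_cvgr _ _ _ _ (cst 0) g)
  => //; [by near=> x; rewrite fg /= normr_ge0|exact: cvg_cst]).
Unshelve. all: by end_near. Qed.

End decay.

(** * Darboux transformation *)

Section logarithmic_derivative.
Context {R : realType}.
Local Open Scope classical_set_scope.
Local Open Scope ring_scope.
Variables (u u' V : R -> R) (kappa : R).
Hypotheses (kappa_gt0 : 0 < kappa) (uu' : is_deriv u u').
Hypothesis u'u : is_deriv u' (fun x => (kappa ^+ 2 - V x) * u x).
Hypothesis u_neq0 : forall x, u x != 0.
Hypotheses (du : decays u) (du' : decays u') (dV : decays V).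

(** Far out, q^2 > 0 and V < kappa^2, so (u u')' = u^2 (q^2 + kappa^2 - V) is nonnegative. Hence u
    u' increases to its limit 0 and is nonpositive there, which selects the negative square root of
    q^2. *)
Lemma logderiv_cvg :
  (u' x / u x) ^+ 2 @[x --> +oo] --> kappa ^+ 2 ->
  u' x / u x @[x --> +oo] --> - kappa.
Proof.
move=> q2.
have [A uA] : exists A, forall x, A < x -> u x * u' x <= 0.
  have k2 : 0 < kappa ^+ 2 by rewrite exprn_gt0.
  have /cvgrPdist_lt/(_ _ k2)[A [_ hA]] := q2.
  have /cvgrPdist_lt/(_ _ k2)[B [_ hB]] := dV.1.
  exists (Num.max A B) => x; rewrite gt_max => /andP[Ax Bx].
  have [uu0 _] := decaysM du du'.
  apply: (cvgr_to_ge uu0); near=> y => /=.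
  have dU := is_derivM uu' u'u.
  have xy : x <= y by near: y; apply: nbhs_pinfty_ge; exact: num_real.
  apply: (is_deriv_ndecr dU _ xy) => z /andP[xz _].
  have := hA z (lt_le_trans Ax xz); have := hB z (lt_le_trans Bx xz).
  rewrite sub0r normrN !ltr_norml => /andP[_ Vz] /andP[_ qz].
  have -> : u' z * u' z + u z * ((kappa ^+ 2 - V z) * u z) =
     u z ^+ 2 * ((u' z / u z) ^+ 2 + kappa ^+ 2 - V z) by field.
  by rewrite mulr_ge0 ?sqr_ge0//; lra.
have -> : kappa = Num.sqrt (kappa ^+ 2) by rewrite sqrtr_sqr gtr0_norm.
have h : - Num.sqrt ((u' x / u x) ^+ 2) @[x --> +oo] --> - Num.sqrt (kappa ^+ 2).
  by apply: cvgN; exact: (continuous_cvg _ (@sqrt_continuous R _) q2).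
apply: cvg_trans h; apply: near_eq_cvg; near=> x.
have /uA ux : A < x by near: x; apply: nbhs_pinfty_gt; exact: num_real.
rewrite /= sqrtr_sqr ler0_norm ?opprK//.
rewrite (_ : u' x / u x = (u x * u' x) / u x ^+ 2); last by field.
by rewrite pmulr_lle0 ?invr_gt0 ?exprn_even_gt0 ?u_neq0.
Unshelve. all: by end_near. Qed.

End logarithmic_derivative.

Section logarithmic_derivativeNy.
Context {R : realType}.
Local Open Scope classical_set_scope.
Local Open Scope ring_scope.

Lemma decays_opp (f : R -> R) : decays f -> decays (fun x => f (- x)).
Proof.
move=> [f1 f2]; split.
  by move/cvgNy_compNP : f2.
by move/cvgy_compNP : f1.
Qed.

Lemma logderiv_cvgNy (u u' V : R -> R) (kappa : R) : 0 < kappa ->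
  is_deriv u u' -> is_deriv u' (fun x => (kappa ^+ 2 - V x) * u x) ->
  (forall x, u x != 0) -> decays u -> decays u' -> decays V ->
  (u' x / u x) ^+ 2 @[x --> -oo] --> kappa ^+ 2 ->
  u' x / u x @[x --> -oo] --> kappa.
Proof.
move=> k0 uu' u'u u0 du du' dV q2.
have := @logderiv_cvg R (fun x => u (- x)) (fun x => - u' (- x)) (fun x => V (- x))
  kappa k0 (is_deriv_opp uu').
have dd : is_deriv (fun x => - u' (- x)) (fun x => (kappa ^+ 2 - V (- x)) * u (- x)).
  apply: is_deriv_eq; first exact: is_derivN (is_deriv_opp u'u).
  by move=> x /=; rewrite opprK.
move=> /(_ dd (fun x => u0 _) (decays_opp du) (decaysN (decays_opp du'))).
move=> /(_ (decays_opp dV)).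
have h2 : (- u' (- x) / u (- x)) ^+ 2 @[x --> +oo] --> kappa ^+ 2.
  move/cvgNy_compNP : q2 => h; apply: cvg_trans h.
  by apply: near_eq_cvg; near=> x; rewrite mulNr sqrrN.
move=> /(_ h2) /cvgN; rewrite opprK => h.
apply/cvgNy_compNP; apply: cvg_trans h; apply: near_eq_cvg; near=> x.
by rewrite /= !fctE mulNr opprK.
Unshelve. all: by end_near. Qed.

End logarithmic_derivativeNy.

(** The index type and [nu] stay fixed while the Darboux step shrinks [S]; the density runs over [S]
    only, so discarded components no longer act on the others. *)
Definition decaying_system {R : realType} {I : finType} (S : {set I})
    (nu : I -> R) (u u' : I -> R -> R) :=
  forall i, i \in S -> [/\ is_deriv (u i) (u' i),
    is_deriv (u' i) (fun x => - (2 * (\sum_(j in S) u j x ^+ 2) + nu i) * u i x),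
    decays (u i) & decays (u' i)].

(** * One Darboux step at the lowest spectral value *)

Section lowest_mode.
Context {R : realType} {I : finType}.
Local Open Scope classical_set_scope.
Local Open Scope ring_scope.
Variables (S : {set I}) (nu : I -> R) (u u' : I -> R -> R) (i0 : I).
Hypotheses (sys : decaying_system S nu u u') (i0S : i0 \in S).
Hypotheses (nu_min : forall j, j \in S -> nu i0 <= nu j) (nu_lt0 : nu i0 < 0).

Let V x := \sum_(j in S) u j x ^+ 2.
Let W j x := u i0 x * u' j x - u j x * u' i0 x.

Let V_ge0 x : 0 <= V x.
Proof. by rewrite sumr_ge0// => j _; rewrite sqr_ge0. Qed.

Let decaysV : decays V.
Proof. by apply: decays_sum => j jS; apply: decays_sqr; have [] := sys jS. Qed.

Let decaysW j : j \in S -> decays (W j).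
Proof.
move=> jS; have [_ _ ? ?] := sys jS; have [_ _ ? ?] := sys i0S.
by apply: decaysB; exact: decaysM.
Qed.

(** Both components solve linear equations with the same potential, which cancels in the Wronskian
    and leaves the difference of the spectral values. *)
Let W' j : j \in S -> is_deriv (W j) (fun x => (nu i0 - nu j) * (u i0 x * u j x)).
Proof.
move=> jS; have [d1 d2 _ _] := sys jS; have [d3 d4 _ _] := sys i0S.
apply: is_deriv_eq; first by apply: is_derivB; apply: is_derivM; eassumption.
by move=> x /=; ring.
Qed.

Let W_eq0 j x : j \in S -> nu j = nu i0 -> W j x = 0.
Proof.
move=> jS e; apply: decays_is_cst0 (decaysW jS) x; apply: is_deriv_is_cst.
by apply: is_deriv_eq (W' jS) _ => x; rewrite e subrr mul0r.
Qed.

(* The terms with nu j = nu i0 vanish both because W j does and because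
   division by zero returns zero. *)
Let first_integral x : u' i0 x ^+ 2 + nu i0 * u i0 x ^+ 2 + u i0 x ^+ 2 * V x
  + \sum_(j in S) W j x ^+ 2 / (nu j - nu i0) = 0.
Proof.
have [d3 d4 du du'] := sys i0S.
set F := fun x => u' i0 x ^+ 2 + nu i0 * u i0 x ^+ 2 + u i0 x ^+ 2 * V x
  + \sum_(j in S) W j x ^+ 2 * (nu j - nu i0)^-1.
suff : F x = 0 by [].
apply: decays_is_cst0; last first.
  apply: decaysD.
    apply: decaysD; last by apply: decaysM => //; exact: decays_sqr.
    by apply: decaysD; [exact: decays_sqr|apply: decaysMl; exact: decays_sqr].
  apply: decays_sum => j jS; under eq_fun do rewrite mulrC.
  by apply: decaysMl; apply: decays_sqr; exact: decaysW.
have dV : is_deriv V (fun x => \sum_(j in S) 2 * u j x * u' j x).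
  by apply: is_deriv_sum => j jS; apply: is_deriv_sqr; have [] := sys jS.
apply: is_deriv_is_cst; apply: is_deriv_eq.
  apply: is_derivD.
    apply: is_derivD; last by apply: is_derivM; [exact: is_deriv_sqr d3|exact: dV].
    apply: is_derivD; first exact: is_deriv_sqr d4.
    by apply: is_derivMl; exact: is_deriv_sqr d3.
  apply: is_deriv_sum => j jS; apply: is_derivM; last exact: is_deriv_cst.
  by apply: is_deriv_sqr; exact: W'.
move=> {}x /=.
(* The weight 1/(nu j - nu i0) cancels the factor in the derivative of [W j]; what remains is the
   opposite of the derivative of the other three terms. *)
have -> : \sum_(j in S) (2 * W j x * ((nu i0 - nu j) * (u i0 x * u j x)) / (nu j - nu i0)
     + W j x ^+ 2 * 0) =
   2 * u i0 x * u' i0 x * V x - u i0 x ^+ 2 * \sum_(j in S) 2 * u j x * u' j x.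
  rewrite /V !mulr_sumr -sumrB; apply: eq_bigr => j jS.
  have [e|e] := eqVneq (nu j) (nu i0).
    have := W_eq0 x jS e; rewrite {2 3}/W => /eqP; rewrite subr_eq0 => /eqP We.
    rewrite e subrr mul0r mulr0 mul0r mulr0 addr0.
    transitivity (2 * u j x * u i0 x * (u j x * u' i0 x - u i0 x * u' j x)); last by ring.
    by rewrite We; ring.
  rewrite /W; field; by rewrite subr_eq0.
by rewrite /V; ring.
Qed.

(** Minimality of [nu i0] enters here: it makes every term of the sum in the first integral
    nonnegative. *)
Let u'_le x : u' i0 x ^+ 2 <= - nu i0 * u i0 x ^+ 2.
Proof.
have := first_integral x.
have : 0 <= \sum_(j in S) W j x ^+ 2 / (nu j - nu i0).
  rewrite sumr_ge0// => j jS.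
  by rewrite mulr_ge0 ?sqr_ge0// invr_ge0 subr_ge0 nu_min.
have : 0 <= u i0 x ^+ 2 * V x by rewrite mulr_ge0 ?sqr_ge0.
lra.
Qed.

Let kappa := Num.sqrt (- nu i0).

Let kappa_gt0 : 0 < kappa.
Proof. by rewrite sqrtr_gt0 oppr_gt0. Qed.

Let kappaE : kappa ^+ 2 = - nu i0.
Proof. by rewrite sqr_sqrtr// oppr_ge0 ltW. Qed.

(* By [u'_le], u^2 exp(-2 kappa x) is nonincreasing and u^2 exp(2 kappa x) is
   nondecreasing. *)
Let u_eq0 x y : u i0 x = 0 -> u i0 y = 0.
Proof.
move=> ux; have [d _ _ _] := sys i0S.
have dexp (c : R) : is_deriv (fun x => expR (c * x)) (fun x => c * expR (c * x)).
  rewrite (_ : (fun x => expR (c * x)) = (fun x => expR (c * x + 0))).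
    apply: is_deriv_eq; first by apply: is_deriv_affine => z; exact: is_derive_expR.
    by move=> z; rewrite addr0.
  by apply/funext => z; rewrite addr0.
have dE c := is_derivM (is_deriv_sqr d) (dexp c).
have bnd z : `|u i0 z * u' i0 z| <= kappa * u i0 z ^+ 2.
  rewrite normrM -[u i0 z ^+ 2]real_normK ?num_real// expr2 mulrCA.
  rewrite ler_wpM2l//.
  rewrite -ler_sqr ?nnegrE ?mulr_ge0 ?(ltW kappa_gt0)//.
  by rewrite exprMn !real_normK ?num_real// kappaE.
suff : u i0 y ^+ 2 <= 0 by rewrite le_eqVlt ltNge sqr_ge0/= orbF sqrf_eq0 => /eqP.
have [xy|/ltW yx] := leP x y.
  have := is_deriv_nincr (dE (- (2 * kappa))) _ xy.
  rewrite ux expr0n/= mul0r pmulr_lle0 ?expR_gt0//; apply => z _ /=.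
  have := bnd z; rewrite ler_norml => /andP[_ b].
  rewrite [_ ^+ 2 * (_ * _)]mulrA -mulrDl pmulr_lle0 ?expR_gt0//.
  by move: b; lra.
have := is_deriv_ndecr (dE (2 * kappa)) _ yx.
rewrite ux expr0n/= mul0r pmulr_lle0 ?expR_gt0//; apply => z _ /=.
have := bnd z; rewrite ler_norml => /andP[b _].
rewrite [_ ^+ 2 * (_ * _)]mulrA -mulrDl mulr_ge0 ?expR_ge0//.
by move: b; lra.
Qed.

Hypothesis u_nontrivial : exists x, u i0 x != 0.

Let u_neq0 x : u i0 x != 0.
Proof.
by have [x0] := u_nontrivial; apply: contra_neq; exact: u_eq0.
Qed.

Let q x := u' i0 x / u i0 x.
(** The first-order Darboux operator d/dx - q applied to [u j]. It equals [W j / u i0], so it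
    vanishes for the whole lowest block. *)
Let v j x := u' j x - q x * u j x.
Let T := [set j in S | nu i0 < nu j]%SET.
(** The transformation turns the potential -2V into -2V - 2q'. With this normalisation q' is the new
    density minus the old one, so the new potential is -2 times the new density and the system keeps
    its form. *)
Let w j x := (Num.sqrt (nu j - nu i0))^-1 * v j x.
Let w' j x := (Num.sqrt (nu j - nu i0))^-1 *
  (- q x * v j x - (nu j - nu i0) * u j x).

Let inT j : (j \in T) = (j \in S) && (nu i0 < nu j).
Proof. by rewrite inE. Qed.

Let w_sqr j x : j \in T -> w j x ^+ 2 = v j x ^+ 2 / (nu j - nu i0).
Proof.
rewrite inT => /andP[_ e]; rewrite /w exprMn exprVn sqr_sqrtr ?subr_ge0 ?ltW//.
by rewrite mulrC.
Qed.

(** This is the first integral divided by [u i0 x ^+ 2]; indices of [S] outside [T] drop out because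
    their Wronskian is zero. *)
Let q_sqr x : q x ^+ 2 = - nu i0 - V x - \sum_(j in T) w j x ^+ 2.
Proof.
have /(congr1 (fun z => z / u i0 x ^+ 2)) := first_integral x; rewrite mul0r.
have -> : \sum_(j in S) W j x ^+ 2 / (nu j - nu i0) =
    u i0 x ^+ 2 * \sum_(j in T) w j x ^+ 2.
  rewrite (bigID (fun j => nu i0 < nu j))/= [X in _ + X]big1 ?addr0; last first.
    move=> j /andP[jS]; rewrite lt_neqAle nu_min// andbT negbK => /eqP e.
    by rewrite W_eq0 ?expr0n ?mul0r.
  rewrite mulr_sumr; apply: eq_big => [j|j /andP[jS e]]; first by rewrite inT.
  have jT : j \in T by rewrite inT jS.
  rewrite w_sqr// /v /q /W; field; rewrite u_neq0/=; lra.
move: (\sum_(j in T) _) (V x) => s Vx e.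
by apply/eqP; rewrite -subr_eq0 -e /q; apply/eqP; field.
Qed.

(** Riccati equation q' = -nu - 2V - q^2, into which [q_sqr] is inserted. *)
Let q' : is_deriv q (fun x => \sum_(j in T) w j x ^+ 2 - V x).
Proof.
have [d1 d2 _ _] := sys i0S.
apply: is_deriv_eq; first by apply: is_derivM d2 _; exact: is_derivV d1.
move=> x /=; have := q_sqr x; rewrite -/(V x) /q => e.
have -> : \sum_(j in T) w j x ^+ 2 = - nu i0 - V x - (u' i0 x / u i0 x) ^+ 2.
  by rewrite e; ring.
by field.
Qed.

(** By the Riccati equation the potential 2V cancels in u_j'' - q' u_j, which leaves a first-order
    relation between [u j] and [v j]. *)
Let v' j : j \in S -> is_deriv (v j) (fun x => - q x * v j x - (nu j - nu i0) * u j x).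
Proof.
move=> jS; have [d1 d2 _ _] := sys jS.
apply: is_deriv_eq; first by apply: is_derivB d2 _; exact: is_derivM q' d1.
move=> x /=; rewrite -/(V x).
have -> : \sum_(j in T) w j x ^+ 2 = - nu i0 - V x - q x ^+ 2 by rewrite q_sqr; ring.
by rewrite /v; ring.
Qed.

Let q_le x : `|q x| <= kappa.
Proof.
rewrite -ler_sqr ?nnegrE ?mulr_ge0 ?(ltW kappa_gt0)//.
rewrite real_normK ?num_real// kappaE q_sqr -addrA gerDl -opprD oppr_le0 addr_ge0//.
by rewrite sumr_ge0// => j _; rewrite sqr_ge0.
Qed.

Let decays_qM f : decays f -> decays (fun x => q x * f x).
Proof.
move=> [f1 f2]; apply: (@decays_le _ _ (fun x => kappa * `|f x|)) => [x|].
  by rewrite normrM ler_wpM2r.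
by apply: decaysMl; split; apply/norm_cvg0P.
Qed.

Let decays_v j : j \in S -> decays (v j).
Proof. by move=> jS; have [_ _ ? ?] := sys jS; apply: decaysB => //; exact: decays_qM. Qed.

Lemma darboux_system : decaying_system T nu w w'.
Proof.
move=> j jT; move: (jT); rewrite inT => /andP[jS e]; have [d1 d2 d3 d4] := sys jS.
have dv := v' jS.
split.
- exact: is_derivMl.
- apply: is_deriv_eq.
    apply: is_derivMl; apply: is_derivB; last exact: is_derivMl d1.
    by apply: is_derivM dv; exact: is_derivN q'.
  move=> x /=.
  have -> : V x = - nu i0 - q x ^+ 2 - \sum_(j in T) w j x ^+ 2 by rewrite q_sqr; ring.
  by rewrite /w /v; ring.
- by apply: decaysMl; exact: decays_v.
- apply: decaysMl; apply: decaysB; last exact: decaysMl.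
  under eq_fun do rewrite mulNr.
  by apply: decaysN; apply: decays_qM; exact: decays_v.
Qed.

(** If [w j] vanished identically, so would [v j] and its derivative, and the equation for [v j]
    would reduce to (nu j - nu i0) u_j = 0. This carries nontriviality through the induction. *)
Lemma darboux_nontrivial j : j \in T -> (exists x, u j x != 0) -> exists x, w j x != 0.
Proof.
move=> jT [x ux]; apply: contrapT => nw; move/negP: ux; apply.
move: (jT); rewrite inT => /andP[jS e].
have v0 : v j = fun=> 0.
  apply/funext => y; apply: contrapT => vy; apply: nw; exists y.
  apply: mulf_neq0; last exact/eqP.
  by rewrite invr_eq0 gt_eqF// sqrtr_gt0 subr_gt0.
have := v' jS x; rewrite v0 => -[_]; rewrite derive_cst mulr0 sub0r => /esym/eqP.
by rewrite oppr_eq0 mulf_eq0 subr_eq0 gt_eqF.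
Qed.

(* v_j' + q v_j = - (nu j - nu i0) u_j gives
   (u_j v_j)' = v_j^2 - (nu j - nu i0) u_j^2. *)
Lemma darboux_sqr j : j \in T ->
  is_deriv (fun x => (nu j - nu i0)^-1 * (u j x * v j x))
           (fun x => w j x ^+ 2 - u j x ^+ 2).
Proof.
move=> jT; move: (jT); rewrite inT => /andP[jS e]; have [d1 _ _ _] := sys jS.
apply: is_deriv_eq; first by apply: is_derivMl; apply: is_derivM d1 (v' jS).
move=> x /=; rewrite w_sqr// /v; field; lra.
Qed.

Let decays_uv j : j \in T -> decays (fun x => (nu j - nu i0)^-1 * (u j x * v j x)).
Proof.
rewrite inT => /andP[jS _]; have [_ _ ? _] := sys jS.
by apply: decaysMl; apply: decaysM => //; exact: decays_v.
Qed.

(** Encodes a total mass 2l as the increase of a primitive, so that no integral is handled during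
    the induction. The symmetric limits fix the additive constant, and adding a decaying function to
    [G] does not affect [l]. *)
Definition primitive_pm (f : R -> R) (l : R) := exists2 G : R -> R, is_deriv G f &
  G x @[x --> +oo] --> l /\ G x @[x --> -oo] --> - l.

(** Since -q' is V minus the sum of the w_j^2, adding the functions of [darboux_sqr] leaves V minus
    the sum of the u_j^2 over [T]. These functions decay, so the limits are those of -q. *)
Lemma lowest_block :
  primitive_pm (fun x => \sum_(j in S | nu j == nu i0) u j x ^+ 2) kappa.
Proof.
exists (fun x => \sum_(j in T) (nu j - nu i0)^-1 * (u j x * v j x) - q x).
  apply: is_deriv_eq.
    by apply: is_derivB q'; apply: is_deriv_sum => j jT; exact: darboux_sqr.
  move=> x /=; rewrite /V sumrB (bigID (fun j => nu j == nu i0) (fun j => j \in S))/=.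
  have -> : \sum_(j in S | nu j != nu i0) u j x ^+ 2 = \sum_(j in T) u j x ^+ 2.
    apply: eq_bigl => j; rewrite inT lt_neqAle eq_sym.
    by have [/nu_min ->|] := boolP (j \in S); rewrite ?andbT ?andbF.
  ring.
have dS : decays (fun x => \sum_(j in T) (nu j - nu i0)^-1 * (u j x * v j x)).
  by apply: decays_sum => j; exact: decays_uv.
have [d1 d2 du du'] := sys i0S.
have dw : decays (fun x => V x + \sum_(j in T) w j x ^+ 2).
  apply: decaysD => //; apply: decays_sum => j jT; apply: decays_sqr.
  by have [] := darboux_system jT.
have d2' : is_deriv (u' i0) (fun x => (kappa ^+ 2 - 2 * V x) * u i0 x).
  by apply: is_deriv_eq d2 _ => x; rewrite kappaE -/(V x); ring.
have q2 (F : set_system R) : Filter F ->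
    (V x + \sum_(j in T) w j x ^+ 2) @[x --> F] --> 0 -> q x ^+ 2 @[x --> F] --> kappa ^+ 2.
  move=> FF h; rewrite -[kappa ^+ 2]subr0.
  rewrite (_ : (fun x => _) = fun x => kappa ^+ 2 - (V x + \sum_(j in T) w j x ^+ 2)).
    by apply: cvgB => //; exact: cvg_cst.
  by apply/funext => x; rewrite q_sqr kappaE opprD addrA.
split.
- rewrite -[kappa]opprK -sub0r; apply: cvgB; first exact: dS.1.
  exact: (logderiv_cvg kappa_gt0 d1 d2' u_neq0 du du' (decaysMl 2 decaysV) (q2 _ _ dw.1)).
- rewrite -[- kappa]sub0r; apply: cvgB; first exact: dS.2.
  exact: (logderiv_cvgNy kappa_gt0 d1 d2' u_neq0 du du' (decaysMl 2 decaysV) (q2 _ _ dw.2)).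
Qed.

Lemma darboux_block (m l : R) : nu i0 < m ->
  primitive_pm (fun x => \sum_(j in T | nu j == m) w j x ^+ 2) l ->
  primitive_pm (fun x => \sum_(j in S | nu j == m) u j x ^+ 2) l.
Proof.
move=> im [H H' [Hp Hm]].
have dS : decays (fun x => \sum_(j in T | nu j == m) (nu j - nu i0)^-1 * (u j x * v j x)).
  by apply: decays_sum => j /andP[jT _]; exact: decays_uv.
exists (fun x => H x - \sum_(j in T | nu j == m) (nu j - nu i0)^-1 * (u j x * v j x)).
  apply: is_deriv_eq.
    by apply: is_derivB H' _; apply: is_deriv_sum => j /andP[jT _]; exact: darboux_sqr.
  (* As [nu i0 < m], all indices of [S] with value [m] lie in [T]. *)
  move=> x /=; rewrite sumrB opprB addrCA subrr addr0; apply: eq_bigl => j.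
  by rewrite inT -andbA; congr andb; case: eqVneq => [->|]; rewrite ?im ?andbF.
split.
- by rewrite -[l]subr0; apply: cvgB => //; exact: dS.1.
- by rewrite -[- l]subr0; apply: cvgB => //; exact: dS.2.
Qed.

Lemma card_darboux : (#|T| < #|S|)%N.
Proof.
apply: proper_card; apply/properP; split.
  by apply/fintype.subsetP => j; rewrite inT => /andP[].
by exists i0; rewrite // inT ltxx andbF.
Qed.

End lowest_mode.

(** * Induction over the components *)

Section block_masses.
Context {R : realType} {I : finType}.

(** Induction on the size of [S], with [i0] a component of lowest value. If [u i0] vanishes
    identically, only this index is dropped, since others with the same value may survive. Otherwise
    either [i] belongs to the lowest block, or a Darboux step removes that block and preserves the
    mass of the block of [i]. *)
Lemma block_primitive (nu : I -> R) (S : {set I}) (u u' : I -> R -> R) (i : I) :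
  decaying_system S nu u u' -> (forall j, j \in S -> nu j < 0) ->
  i \in S -> (exists x, u i x != 0) ->
  primitive_pm (fun x => \sum_(j in S | nu j == nu i) u j x ^+ 2) (Num.sqrt (- nu i)).
Proof.
have [n] := ubnP #|S|; elim: n => // n IH in S u u' *; rewrite ltnS => Sn sys neg iS ui.
have [i0 i0S nu_min] : exists2 i0, i0 \in S & forall j, j \in S -> nu i0 <= nu j.
  by case: (arg_minP nu iS) => i0 i0S h; exists i0.
have [nz|z] := pselect (exists x, u i0 x != 0).
  have [e|ne] := eqVneq (nu i) (nu i0).
    by rewrite e; apply: lowest_block sys i0S nu_min (neg _ i0S) nz.
  have lt : nu i0 < nu i by rewrite lt_neqAle eq_sym ne nu_min.
  apply: (darboux_block sys i0S nu_min (neg _ i0S) nz lt).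
  have iT : i \in [set j in S | nu i0 < nu j]%SET by rewrite inE iS.
  have wi := darboux_nontrivial sys i0S nu_min (neg _ i0S) nz iT ui.
  apply: IH (darboux_system sys i0S nu_min (neg _ i0S) nz) _ iT wi.
  - by apply: leq_trans Sn; exact: card_darboux.
  - by move=> j; rewrite inE => /andP[/neg].
have u0 x : u i0 x = 0 by apply: contrapT => /eqP ux; apply: z; exists x.
have ii0 : i != i0 by apply/eqP => e; apply: z; rewrite -e.
(* Dropping a zero component changes neither the mass of a block nor the density in the equations;
   both cases of [P] are used below. *)
have sumE (P : pred I) x :
    \sum_(j in S | P j) u j x ^+ 2 = \sum_(j in (S :\ i0)%SET | P j) u j x ^+ 2.
  rewrite big_mkcondr [RHS]big_mkcondr/= (big_setD1 i0)//= u0 expr0n if_same add0r.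
  by [].
under eq_fun do rewrite sumE.
apply: IH.
- by move: Sn; rewrite (cardsD1 i0) i0S.
- move=> j; rewrite in_setD1 => /andP[_ jS]; have [d1 d2 d3 d4] := sys _ jS.
  split => //; apply: is_deriv_eq d2 _ => x.
  by have := sumE xpredT x; rewrite !big_mkcondr/= => ->.
- by move=> j; rewrite in_setD1 => /andP[_ /neg].
- by rewrite in_setD1 ii0.
- exact: ui.
Qed.

End block_masses.

(** * Smooth bump functions *)

Section smooth_functions.
Context {R : realType}.
Local Open Scope classical_set_scope.
Local Open Scope ring_scope.
Implicit Types f g : R -> R.

(** The successive derivatives are given as a sequence, so that differences, rescalings and
    primitives are treated term by term, without computing [derive1n]. *)
Definition smooth f := exists2 F : nat -> R -> R,
  F 0%N = f & forall n, is_deriv (F n) (F n.+1).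

Lemma smooth_derive1n f n : smooth f ->
  forall x : R, derivable (derive1n n f) x 1.
Proof.
move=> [F <- F'] x.
suff -> : derive1n n (F 0%N) = F n by have [] := F' n x.
elim: n => // n; rewrite derive1nS => ->; apply/funext => y.
by rewrite derive1E; have [_ ->] := F' n y.
Qed.

Lemma smooth_primitive f g : is_deriv f g -> smooth g -> smooth f.
Proof.
move=> fg [G G0 G']; exists (fun n => if n is n'.+1 then G n' else f) => //.
by case; rewrite ?G0.
Qed.

Lemma smoothB f g : smooth f -> smooth g -> smooth (fun x => f x - g x).
Proof.
move=> [F <- F'] [G <- G']; exists (fun n x => F n x - G n x) => // n.
exact: is_derivB.
Qed.

Lemma smoothMl (c : R) f : smooth f -> smooth (fun x => c * f x).
Proof.
move=> [F <- F']; exists (fun n x => c * F n x) => // n; exact: is_derivMl.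
Qed.

Lemma smooth_affine (c d : R) f : smooth f -> smooth (fun x => f (c * x + d)).
Proof.
move=> [F <- F']; exists (fun n x => c ^+ n * F n (c * x + d)).
  by apply/funext => x; rewrite expr0 mul1r.
move=> n; apply: is_deriv_eq; first by apply: is_derivMl; exact: is_deriv_affine.
by move=> x; rewrite exprS mulrCA mulrA.
Qed.

(** Serves for [bump] at the points with |x| >= 1: the edge of the support and its outside are
    covered at once. *)
Lemma is_derive0_quadratic f (C x : R) : 0 <= C ->
  f x = 0 -> (forall y, `|f y| <= C * (y - x) ^+ 2) -> is_derive x (1 : R) f 0.
Proof.
move=> C0 fx fC.
have D : h^-1 *: ((f \o shift x) (h *: (1 : R)) - f x) @[h --> 0^'] --> (0 : R).
  apply/norm_cvg0P; apply: (@squeeze_cvgr _ _ _ _ (cst 0) (fun h => C * `|h|)).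
  - near=> h; rewrite /= normr_ge0/= fx subr0 normrM normfV.
    have h0 : h != 0 by near: h; exact: nbhs_dnbhs_neq.
    rewrite ler_pdivrMl ?normr_gt0//; apply: (le_trans (fC _)).
    rewrite /shift/= /GRing.scale/= mulr1 addrK.
    by rewrite -[h ^+ 2]real_normK ?num_real// expr2 mulrCA.
  - exact: cvg_cst.
  - rewrite -[X in _ --> X](mulr0 C); apply: cvgM; first exact: cvg_cst.
    rewrite -[X in _ --> X](@normr0 _ R).
    by apply: cvg_norm; apply: cvg_within_filter; exact: cvg_id.
by apply: DeriveDef; [apply/cvg_ex; exists 0|exact: cvg_lim].
Unshelve. all: by end_near. Qed.

End smooth_functions.

Section bump.
Context {R : realType}.
Local Open Scope classical_set_scope.
Local Open Scope ring_scope.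
Implicit Types (P : {poly R}) (x : R) (k : nat).

(** The standard bump is P = 1, k = 0. The polynomial and the pole make the family stable under
    differentiation, so one derivative formula gives smoothness. *)
Definition bump P k x : R :=
  if `|x| < 1 then P.[x] / (1 - x ^+ 2) ^+ k * expR (- (1 - x ^+ 2)^-1) else 0.

Let s_gt0 x : `|x| < 1 -> 0 < 1 - x ^+ 2.
Proof. by move=> x1; rewrite subr_gt0 -real_normK ?num_real// exprn_ilt1. Qed.

(** This is e^t >= (t/n)^n, from e^(t/n) >= 1 + t/n, at t = 1/s and n = m + 1. *)
Lemma expRN_inv_le (m : nat) (s : R) : 0 < s -> expR (- s^-1) <= (m.+1%:R * s) ^+ m.+1.
Proof.
move=> s0; rewrite expRN -[leRHS]invrK -exprVn lef_pV2 ?posrE ?expR_gt0//; last first.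
  by rewrite exprn_gt0// invr_gt0 mulr_gt0.
have -> : s^-1 = m.+1%:R * (m.+1%:R * s)^-1 by rewrite invfM mulrA divff ?mul1r// pnatr_eq0.
rewrite expRM_natl; apply: lerXn2r; rewrite ?nnegrE ?expR_ge0//.
  by rewrite invr_ge0 mulr_ge0// ltW.
by apply: le_trans (expR_ge1Dx _); rewrite lerDr.
Qed.

Lemma horner_bounded P : exists2 C, 0 <= C & forall x, `|x| < 1 -> `|P.[x]| <= C.
Proof.
exists (\sum_(i < size P) `|P`_i|); first by rewrite sumr_ge0.
move=> x x1; rewrite horner_coef; apply: le_trans (ler_norm_sum _ _ _) _.
apply: ler_sum => i _; rewrite normrM ler_piMr// normrX.
by rewrite exprn_ile1// ltW.
Qed.

(** With exponent k + 2, [expRN_inv_le] absorbs the pole of order k and leaves s^2 for s = 1 - y^2.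
    Moreover s <= 2 |y - x|, because 1 - |y| <= |x| - |y| and 1 + |y| <= 2; hence the factor 4. *)
Lemma bump_quadratic P k : exists2 C, 0 <= C &
  forall x y, 1 <= `|x| -> `|bump P k y| <= C * (y - x) ^+ 2.
Proof.
have [C C0 PC] := horner_bounded P.
exists (C * (k.+2%:R ^+ k.+2 * 4)) => [|x y x1].
  by rewrite mulr_ge0// mulr_ge0// exprn_ge0.
rewrite /bump; case: ifPn => [y1|_]; last first.
  by rewrite normr0 mulr_ge0 ?sqr_ge0// mulr_ge0// mulr_ge0// exprn_ge0.
have s0 := s_gt0 y1; set s := 1 - y ^+ 2 in s0 *.
rewrite -mulrA normrM -mulrA ler_pM//; first exact: PC.
rewrite ger0_norm ?mulr_ge0 ?expR_ge0 ?invr_ge0 ?exprn_ge0 ?(ltW s0)//.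
apply: (@le_trans _ _ ((s ^+ k)^-1 * (k.+2%:R * s) ^+ k.+2)).
  by rewrite ler_wpM2l ?expRN_inv_le// invr_ge0 exprn_ge0// ltW.
rewrite exprMn mulrCA -mulrA ler_wpM2l ?exprn_ge0//.
rewrite -[in X in _ * X]addn2 exprD mulKf ?expf_neq0 ?gt_eqF//.
have -> : 4 * (y - x) ^+ 2 = (2 * `|y - x|) ^+ 2 :> R.
  by rewrite exprMn real_normK ?num_real//; ring.
apply: lerXn2r; rewrite ?nnegrE ?mulr_ge0 ?(ltW s0)//.
have -> : s = (1 - `|y|) * (1 + `|y|).
  by rewrite /s -[y ^+ 2]real_normK ?num_real//; ring.
rewrite mulrC ler_pM ?subr_ge0 ?(ltW y1)// ?addr_ge0//.
  by have := ltW y1; lra.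
by rewrite distrC; have := lerB_dist x y; lra.
Qed.

(** Numerator of the derivative over the common denominator (1 - x^2)^(k+2). *)
Let dbump P k : {poly R} := P^`() * (1 - 'X^2) ^+ 2
  + (2 * k%:R)%:P * 'X * P * (1 - 'X^2) - 2%:P * 'X * P.

Lemma is_deriv_bump P k : is_deriv (bump P k) (bump (dbump P k) k.+2).
Proof.
move=> x; have [x1|x1] := ltP `|x| 1; last first.
  rewrite {2}/bump ltNge x1/=.
  have [C C0 bC] := bump_quadratic P k.
  by apply: (is_derive0_quadratic C0) => [|y]; [rewrite /bump ltNge x1|exact: bC].
have s0 := s_gt0 x1.
have near1 : \forall y \near x, `|y| < 1.
  have /cvgr_lt : `|y| @[y --> x] --> `|x| by apply: cvg_norm; exact: cvg_id.
  exact.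
pose b y := P.[y] * (((1 - y ^+ 2) ^+ k)^-1 * expR (- (1 - y ^+ 2)^-1)).
apply: (@near_eq_is_derive _ _ _ b (bump P k)).
  near=> y; have y1 : `|y| < 1 by near: y.
  by rewrite /bump y1 /b mulrA.
pose s (y : R) := 1 - y ^+ 2.
have ds : is_derive x (1 : R) s (- (2 * x)).
  by apply: is_derive_eq; rewrite /GRing.scale/=; ring.
have sn : s x != 0 by rewrite gt_eqF.
have dV := is_deriveV sn ds.
have dk := is_deriveX k ds.
have skn : (s ^+ k) x != 0 by rewrite fctE expf_neq0.
have dVk := is_deriveV skn dk.
have de := @is_derive1_comp _ expR (- (fun y => (s y)^-1)) x _ _
  (is_derive_expR _) (is_deriveN dV).
have := is_deriveM (is_derive_poly P x) (is_deriveM dVk de).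
have -> : b = (fun y => P.[y]) * ((fun y => ((s ^+ k) y)^-1) * (expR \o - (fun y => (s y)^-1))).
  by apply/funext => y; rewrite /b !fctE.
move=> h; apply: is_derive_eq h _.
move: sn skn; rewrite !fctE => sn skn.
rewrite /bump x1 /dbump /GRing.scale/= !hornerE -/(s x).
clear -sn; move: (expR _) => e; case: k => [|k] /=.
  rewrite !expr0; field.
  exact: sn.
rewrite !exprS; field.
by rewrite sn expf_neq0.
Unshelve. all: by end_near. Qed.

Lemma smooth_bump P k : smooth (bump P k).
Proof.
pose F n := iter n (fun Qj : {poly R} * nat => (dbump Qj.1 Qj.2, Qj.2.+2)) (P, k).
exists (fun n => bump (F n).1 (F n).2) => // n; exact: is_deriv_bump.
Qed.

Lemma exists_bump : exists rho : R -> R, [/\ smooth rho,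
  forall x, 0 <= rho x <= 1, forall x, 1 <= `|x| -> rho x = 0 &
  forall x, `|x| < 1 -> 0 < rho x].
Proof.
exists (bump 1 0); split; first exact: smooth_bump.
- move=> x; rewrite /bump; case: ifPn => [x1|_]; last by rewrite lexx ler01.
  rewrite hornerE expr0 divr1 mul1r expR_ge0/= -[leRHS]expR0 ler_expR oppr_le0.
  by rewrite invr_ge0; exact/ltW/s_gt0.
- by move=> x x1; rewrite /bump ltNge x1.
- by move=> x x1; rewrite /bump x1 hornerE expr0 divr1 mul1r expR_gt0.
Qed.

End bump.

(** * Weak derivatives *)

Section almost_everywhere.
Context {R : realType}.
Local Notation mu := (@lebesgue_measure R).
Local Open Scope classical_set_scope.
Local Open Scope ring_scope.
Implicit Types P Q : R -> Prop.

Lemma ae_imply P Q : (forall x, P x -> Q x) ->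
  {ae mu, forall x, P x} -> {ae mu, forall x, Q x}.
Proof. by move=> PQ; apply: negligibleS => x; apply: contra_not; exact: PQ. Qed.

Lemma ae_conj P Q : {ae mu, forall x, P x} -> {ae mu, forall x, Q x} ->
  {ae mu, forall x, P x /\ Q x}.
Proof.
move=> aP aQ; apply: negligibleS (negligibleU aP aQ) => x /= /not_andP[]; by [left|right].
Qed.

Lemma ae_exists P : {ae mu, forall x, P x} -> exists x, P x.
Proof.
move=> aP; apply: contrapT => nP.
have : mu `[0, 1]%classic = 0%E.
  apply: measure_negligible => //.
  by apply: negligibleS aP => x _ /= Px; apply: nP; exists x.
rewrite lebesgue_measure_itv/= lte_fin ltr01 sube0 => /eqP.
by rewrite eqe oner_eq0.
Qed.

End almost_everywhere.

Section locally_integrable_functions.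
Context {R : realType}.
Local Notation mu := (@lebesgue_measure R).
Local Open Scope classical_set_scope.
Local Open Scope ring_scope.
Implicit Types f g : R -> R.

Definition itv_integrable f := measurable_fun [set: R] f /\
  forall a b : R, mu.-integrable `[a, b] (EFin \o f).

Lemma itv_integrableS f (a b : R) (A : set R) : itv_integrable f ->
  measurable A -> A `<=` `[a, b] -> mu.-integrable A (EFin \o f).
Proof. by move=> [_ fi] mA Aab; apply: integrableS (fi a b). Qed.

Lemma continuous_itv_integrable f : continuous f -> itv_integrable f.
Proof.
move=> cf; split; first exact: continuous_measurable_fun.
move=> a b; apply: continuous_compact_integrable; first exact: segment_compact.
exact: continuous_subspaceT.
Qed.

Lemma itv_integrable_norm f : itv_integrable f -> itv_integrable (fun x => `|f x|).
Proof.
move=> [mf fi]; split; first exact: measurableT_comp.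
move=> a b; exact: integrable_norm (fi a b).
Qed.

Lemma itv_integrableB f g : itv_integrable f -> itv_integrable g ->
  itv_integrable (fun x => f x - g x).
Proof.
move=> [mf fi] [mg gi]; split; first exact: measurable_funB.
move=> a b; rewrite (_ : EFin \o _ = ((EFin \o f) \- (EFin \o g))%E)//.
exact: integrableB.
Qed.

Lemma itv_integrableM f g (M : R) : itv_integrable f -> measurable_fun [set: R] g ->
  (forall x, `|g x| <= M) -> itv_integrable (fun x => f x * g x).
Proof.
move=> [mf fi] mg gM; split; first exact: measurable_funM.
move=> a b; rewrite (_ : EFin \o _ = ((EFin \o f) \* (EFin \o g))%E)//.
apply: (integrableMl _ (fi a b)) => //.
  exact: measurable_funS mg.
exists M; split; first exact: num_real.
by move=> z Mz x _ /=; apply: le_trans (gM x) (ltW Mz).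
Qed.

Lemma Lfun2_itv_integrable f : f \in Lfun mu 2%:E -> itv_integrable f.
Proof.
move=> f2; have mf : measurable_fun [set: R] f.
  by move: f2; rewrite inE => /andP[]; rewrite inE.
split=> // a b.
(* The dominating function comes from |f| <= 1 + f^2. *)
have i1 : mu.-integrable `[a, b] (EFin \o (fun x => 1 + f x ^+ 2)).
  rewrite (_ : EFin \o _ = ((EFin \o cst 1%R) \+ (EFin \o (fun x => f x ^+ 2)%R))%E)//.
  apply: integrableD => //.
    exact: (continuous_itv_integrable (fun x => cvg_cst _)).2.
  by apply: (integrableS _ _ _ (Lfun2_integrable_sqr f2)).
apply: le_integrable i1 => //.
  by apply/measurable_EFinP; exact: measurable_funS mf.
move=> x _ /=; rewrite lee_fin [leRHS]ger0_norm ?addr_ge0 ?sqr_ge0//.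
rewrite -[f x ^+ 2]real_normK ?num_real//.
have := sqr_ge0 (`|f x| - 1); nra.
Qed.

Lemma itv_integrable_locally f : itv_integrable f -> locally_integrable [set: R] f.
Proof.
move=> [mf fi]; split; [by []|exact: openT|move=> K _ cK].
have [M [_ MK]] := compact_bounded cK.
have Kab : K `<=` `[- (M + 1), M + 1].
  move=> x Kx; rewrite /= in_itv/= -ler_norml.
  by apply: (MK (M + 1)) => //; rewrite ltrDl.
have /integrableP[_] := itv_integrableS (conj mf fi) (compact_measurable cK) Kab.
by [].
Qed.

Lemma Rintegral_chasles f (a b c : R) : itv_integrable f -> a <= b -> b <= c ->
  \int[mu]_(x in `[a, c]) f x = \int[mu]_(x in `[a, b]) f x + \int[mu]_(x in `[b, c]) f x.
Proof.
move=> fi ab bc; apply/eqP; rewrite addrC -subr_eq; apply/eqP.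
rewrite Rintegral_itvB ?bnd_simp//; last exact: fi.2.
rewrite Rintegral_itv_obnd_cbnd//; apply: itv_integrableS fi _ _ => //.
exact: subset_itv_oc_cc.
Qed.

Lemma exists_primitive f : itv_integrable f -> exists F : R -> R,
  [/\ continuous F,
      forall a b, a <= b -> \int[mu]_(x in `[a, b]) f x = F b - F a &
      forall x, {for x, continuous f} -> is_derive x (1 : R) F (f x)].
Proof.
move=> fi.
pose F x := if 0 <= x then \int[mu]_(t in `[0, x]) f t else - \int[mu]_(t in `[x, 0]) f t.
have FE a b : a <= b -> \int[mu]_(x in `[a, b]) f x = F b - F a.
  move=> ab; rewrite /F; have [a0|a0] := leP 0 a.
    rewrite (le_trans a0 ab) (Rintegral_chasles fi a0 ab); ring.
  have [b0|b0] := leP 0 b.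
    by rewrite opprK addrC; apply: Rintegral_chasles => //; exact: ltW.
  rewrite opprK addrC (Rintegral_chasles fi ab (ltW b0)); ring.
(* Near x, [F] differs by a constant from the integral based at x - 1. This makes x an interior
   point and treats both signs of x alike. *)
have FE' x y : x - 1 <= y ->
    \int[mu]_(t in `[x - 1, y]) f t + F (x - 1) = F y.
  by move=> xy; rewrite FE// subrK.
have near_x (x : R) : \forall y \near x, \int[mu]_(t in `[x - 1, y]) f t + F (x - 1) = F y.
  near=> y; apply: FE'; apply/ltW; near: y; apply: lt_nbhsr.
  by rewrite ltrBlDr ltrDl.
have x1 (x : R) : x < x + 1 by rewrite ltrDl.
have x2 (x : R) : x - 1 < x by rewrite ltrBlDr.
exists F; split=> //.
- move=> x.
  have /(continuous_within_itvP _ (lt_trans (x2 x) (x1 x)))[c0 _ _] :=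
    parameterized_integral_continuous (ltW (lt_trans (x2 x) (x1 x))) (fi.2 (x - 1) (x + 1)).
  have {}c0 : {for x, continuous (fun y => \int[mu]_(t in `[x - 1, y]) f t)}.
    by apply: c0; rewrite in_itv/= x1 x2.
  have h : \int[mu]_(t in `[x - 1, y]) f t + F (x - 1) @[y --> x] --> F x.
    rewrite -[in X in _ --> X](FE' x x) ?(ltW (x2 x))//; apply: cvgD; last exact: cvg_cst.
    exact: c0.
  by apply: cvg_trans h; apply: near_eq_cvg; apply: filterS (near_x x) => y ->.
- move=> x cx.
  have [d1 d2] := continuous_FTC1_closed (x1 x) (fi.2 (x - 1) (x + 1)) (x2 x) cx.
  apply: (near_eq_is_derive (near_x x)).
  rewrite -[f x]addr0; apply: is_deriveD.
  by apply: DeriveDef; [exact: d1|rewrite -derive1E; exact: d2].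
Unshelve. all: by end_near. Qed.

End locally_integrable_functions.

Section weak_derivatives.
Context {R : realType}.
Local Notation mu := (@lebesgue_measure R).
Local Open Scope classical_set_scope.
Local Open Scope ring_scope.
Implicit Types f g u : R -> R.

Lemma Rintegral_support (D : set R) f : (forall x, ~ D x -> f x = 0) ->
  \int[mu]_x f x = \int[mu]_(x in D) f x.
Proof.
move=> fD; rewrite [RHS]Rintegral_mkcond; apply: eq_Rintegral => x _.
by rewrite patchE; case: ifPn => // /negP xD; apply: fD => Dx; apply: xD; rewrite inE.
Qed.

Lemma is_deriv_Rintegral F f (a b : R) : is_deriv F f -> continuous f -> a <= b ->
  \int[mu]_(x in `[a, b]) f x = F b - F a.
Proof.
move=> F' cf ab; have [G [_ GE G']] := exists_primitive (continuous_itv_integrable cf).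
have FG : is_deriv (fun x => F x - G x) (fun=> 0).
  by apply: is_deriv_eq; [apply: is_derivB F' (fun x => G' x (cf x))|move=> x; rewrite subrr].
by rewrite GE//; have := is_deriv_is_cst FG a b; lra.
Qed.

(** The primitive of a bump, normalised to rise from 0 to 1 on [-1, 1]. As the bump is at most 1,
    the inverse of its mass can serve as [M]. *)
Lemma exists_smooth_step : exists theta rho : R -> R, exists M : R,
  [/\ is_deriv theta rho, smooth theta, 0 <= M &
      forall x, [/\ 0 <= rho x <= M, 0 <= theta x <= 1, 1 <= `|x| -> rho x = 0,
        x <= -1 -> theta x = 0 & 1 <= x -> theta x = 1]].
Proof.
have [rho [rho_smooth rho01 rho0 rho_gt0]] := @exists_bump R.
have crho : continuous rho.
  by have [F <- F'] := rho_smooth; exact: is_deriv_continuous (F' 0%N).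
have [F [cF _ F']] := exists_primitive (continuous_itv_integrable crho).
have dF : is_deriv F rho by move=> x; exact: F' (crho x).
have ndF (x y : R) : x <= y -> F x <= F y.
  by apply: is_deriv_ndecr dF _ => z _; have /andP[] := rho01 z.
have Fl x : x <= -1 -> F x = F (-1).
  move=> x1; have [c /andP[_ c1]] := is_deriv_MVT dF x1.
  rewrite rho0 ?mul0r; last by rewrite ler_normr; apply/orP; right; lra.
  by move/eqP; rewrite subr_eq0 => /eqP.
have Fr x : 1 <= x -> F x = F 1.
  move=> x1; have [c /andP[c1 _]] := is_deriv_MVT dF x1.
  rewrite rho0 ?mul0r; last by rewrite ler_normr c1.
  by move/eqP; rewrite subr_eq0 => /eqP.
(* The mean value theorem on [-1/2, 1/2] produces a point where the bump is positive. *)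
have L0 : 0 < F 1 - F (-1).
  have [|c /andP[c1 c2] Fc] := @is_deriv_MVT _ _ _ (- 2^-1) (2^-1) dF; first by lra.
  have : 0 < rho c * (2^-1 - - 2^-1).
    apply: mulr_gt0; last by lra.
    by apply: rho_gt0; rewrite ltr_norml; apply/andP; split; lra.
  have : F (-1) <= F (- 2^-1) by apply: ndF; lra.
  have : F (2^-1) <= F 1 by apply: ndF; lra.
  lra.
exists (fun x => (F 1 - F (-1))^-1 * (F x - F (-1))).
exists (fun x => (F 1 - F (-1))^-1 * rho x), (F 1 - F (-1))^-1.
have Li0 : 0 <= (F 1 - F (-1))^-1 by rewrite invr_ge0 ltW.
have dth : is_deriv (fun x => (F 1 - F (-1))^-1 * (F x - F (-1)))
    (fun x => (F 1 - F (-1))^-1 * rho x).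
  apply: is_deriv_eq; first by apply: is_derivMl; apply: is_derivB dF _; exact: is_deriv_cst.
  by move=> x; rewrite subr0.
split=> //; first exact: smooth_primitive dth (smoothMl _ rho_smooth).
move=> x; have /andP[r0 r1] := rho01 x; split.
- by rewrite mulr_ge0//= ler_piMr.
- have Fm : F (-1) <= F x.
    by have [x1|/ltW x1] := leP x (-1); [rewrite (Fl x)|exact: ndF].
  have FM : F x <= F 1.
    by have [x1|/ltW x1] := leP 1 x; [rewrite (Fr x)|exact: ndF].
  by rewrite mulr_ge0 ?subr_ge0//= mulrC ler_pdivrMr// mul1r lerD2r.
- by move=> x1; rewrite rho0// mulr0.
- by move=> x1; rewrite (Fl x)// subrr mulr0.
- by move=> x1; rewrite (Fr x)// mulVf// gt_eqF.
Qed.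

Lemma cvg_at_right_shift f (c : R) : continuous f ->
  f (c + e) @[e --> 0^'+] --> f c /\ f (c - e) @[e --> 0^'+] --> f c.
Proof.
move=> cf; split; apply: cvg_at_right_filter.
  apply: (@cvg_comp _ _ _ (fun e => c + e) f _ (nbhs c)); last exact: cf.
  by rewrite -{2}[c]addr0; apply: cvgD; [exact: cvg_cst|exact: cvg_id].
apply: (@cvg_comp _ _ _ (fun e => c - e) f _ (nbhs c)); last exact: cf.
by rewrite -{2}[c]subr0; apply: cvgB; [exact: cvg_cst|exact: cvg_id].
Qed.

Section smooth_step.
Variables (theta rho : R -> R) (M : R).
Hypotheses (theta' : is_deriv theta rho) (theta_smooth : smooth theta).
Hypothesis M_ge0 : 0 <= M.
Hypothesis step : forall x, [/\ 0 <= rho x <= M, 0 <= theta x <= 1,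
  1 <= `|x| -> rho x = 0, x <= -1 -> theta x = 0 & 1 <= x -> theta x = 1].

(** A step smoothed over [c - e, c + e], and below its derivative [rh e c], an approximate identity
    at c. The argument keeps the affine shape expected by [is_deriv_affine]. *)
Let th e c x := theta (e^-1 * x + - (e^-1 * c)).
Let rh e c x := e^-1 * rho (e^-1 * x + - (e^-1 * c)).

Let th' e c : is_deriv (th e c) (rh e c).
Proof. exact: is_deriv_affine. Qed.

Let smooth_th e c : smooth (th e c).
Proof. exact: smooth_affine. Qed.

Let crh e c : continuous (rh e c).
Proof.
move=> x; apply: cvgM; first exact: cvg_cst.
apply: (@cvg_comp _ _ _ (fun x => e^-1 * x + - (e^-1 * c)) rho _
    (nbhs (e^-1 * x + - (e^-1 * c)))); last first.
  have [F F0 F'] := theta_smooth.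
  suff -> : rho = F 1%N by exact: is_deriv_continuous (F' 1%N) _.
  apply/funext => y; have [_ <-] := theta' y; have [_ <-] := F' 0%N y.
  by rewrite F0.
by apply: cvgD; [apply: cvgM; [exact: cvg_cst|exact: cvg_id]|exact: cvg_cst].
Qed.

Let argE (e c x : R) : e^-1 * x + - (e^-1 * c) = (x - c) / e.
Proof. by rewrite -mulrN -mulrDr mulrC. Qed.

Let th0 e c x : 0 < e -> x <= c - e -> th e c x = 0.
Proof.
move=> e0 xc; have [_ _ _ h _] := step (e^-1 * x + - (e^-1 * c)).
by apply: h; rewrite argE ler_pdivrMr// mulN1r; lra.
Qed.

Let th1 e c x : 0 < e -> c + e <= x -> th e c x = 1.
Proof.
move=> e0 xc; have [_ _ _ _ h] := step (e^-1 * x + - (e^-1 * c)).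
by apply: h; rewrite argE ler_pdivlMr// mul1r; lra.
Qed.

Let th01 e c x : 0 <= th e c x <= 1.
Proof. by have [] := step (e^-1 * x + - (e^-1 * c)). Qed.

Let rh0 e c x : 0 < e -> ~ ball c e x -> rh e c x = 0.
Proof.
move=> e0 cx; rewrite /rh; have [_ _ h _ _] := step (e^-1 * x + - (e^-1 * c)).
rewrite h ?mulr0// argE normrM normfV (gtr0_norm e0) ler_pdivlMr// mul1r distrC leNgt.
exact/negP.
Qed.

Let rh_ge0 e c x : 0 < e -> 0 <= rh e c x.
Proof.
move=> e0; have [/andP[r0 _] _ _ _ _] := step (e^-1 * x + - (e^-1 * c)).
by rewrite mulr_ge0// invr_ge0 ltW.
Qed.

Let rh_le e c x : 0 < e -> `|rh e c x| <= M / e.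
Proof.
move=> e0; rewrite ger0_norm ?rh_ge0// /rh mulrC ler_wpM2r// ?invr_ge0 ?(ltW e0)//.
by have [/andP[_ r0] _ _ _ _] := step (e^-1 * x + - (e^-1 * c)).
Qed.

Let ball_itv (c e : R) : ball c e `<=` `[c - e, c + e].
Proof.
move=> x; rewrite /ball/= distrC => /ltW; rewrite ler_norml in_itv/= => /andP[? ?].
by apply/andP; split; lra.
Qed.

Let int_rh e c : 0 < e -> \int[mu]_(x in ball c e) rh e c x = 1.
Proof.
move=> e0; rewrite -(@Rintegral_support _ (rh e c)); last by move=> x; exact: rh0.
rewrite (@Rintegral_support `[c - e, c + e]); last first.
  by move=> x nx; apply: rh0 => // /ball_itv.
rewrite (is_deriv_Rintegral (@th' e c) (@crh e c)); last by lra.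
by rewrite th1// th0// subr0.
Qed.

(** As [rh e c] has integral 1, is bounded by M/e and lives on a ball of length 2e, the error is at
    most 2M times the mean of |u - u c| over that ball, which tends to 0 at a Lebesgue point. *)
Lemma approximate_identity u c : itv_integrable u -> lebesgue_pt u c ->
  \int[mu]_x (u x * rh e c x) @[e --> 0^'+] --> u c.
Proof.
move=> ui uc.
pose I e := \int[mu]_(x in ball c e) `|u x - u c|.
have uci : itv_integrable (fun x => u x - u c).
  by apply: itv_integrableB => //; apply: continuous_itv_integrable => x; exact: cvg_cst.
have bint f e : itv_integrable f -> mu.-integrable (ball c e) (EFin \o f).
  move=> fi; apply: itv_integrableS fi _ _; last exact: ball_itv.
  exact: measurable_ball.
have IE e : 0 < e -> davg u c e = ((e *+ 2)^-1 * I e)%:E.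
  move=> e0; rewrite /davg /iavg lebesgue_measure_ball ?(ltW e0)//.
  rewrite inver mulrn_eq0/= gt_eqF// EFinM /I /Rintegral fineK//.
  apply: integrable_fin_num; first exact: measurable_ball.
  exact: bint (itv_integrable_norm uci).
have I0 : (e *+ 2)^-1 * I e @[e --> 0^'+] --> 0.
  apply/(@fine_cvg _ _ _ _ (fun e => ((e *+ 2)^-1 * I e)%:E)).
  apply: cvg_trans uc; apply: near_eq_cvg; near=> e.
  by rewrite IE//; near: e; exact: nbhs_right_gt.
have I1 : 2 * M * ((e *+ 2)^-1 * I e) @[e --> 0^'+] --> 0.
  by rewrite -[X in _ --> X](mulr0 (2 * M)); apply: cvgM => //; exact: cvg_cst.
apply/subr_cvg0; apply/norm_cvg0P.
apply: (@squeeze_cvgr _ _ _ _ (cst 0)) I1; last exact: cvg_cst.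
near=> e; have e0 : 0 < e by near: e; exact: nbhs_right_gt.
rewrite /= normr_ge0/=.
have mrh : measurable_fun [set: R] (rh e c) by apply: continuous_measurable_fun; exact: crh.
rewrite (@Rintegral_support (ball c e)); last by move=> x cx; rewrite rh0// mulr0.
have rhi := continuous_itv_integrable (@crh e c).
have i1 := bint _ e (itv_integrableM uci mrh (fun x => rh_le c x e0)).
have -> : \int[mu]_(x in ball c e) (u x * rh e c x) - u c =
    \int[mu]_(x in ball c e) ((u x - u c) * rh e c x).
  have h1 : u c = \int[mu]_(x in ball c e) (u c * rh e c x).
    by rewrite RintegralZl ?int_rh ?mulr1//; [exact: measurable_ball|exact: bint].
  rewrite [X in _ - X]h1.
  rewrite -RintegralB; last 3 first.
  - exact: measurable_ball.
  - exact: bint (itv_integrableM ui mrh (fun x => rh_le c x e0)).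
  - apply: (bint (fun x => u c * rh e c x)); apply: continuous_itv_integrable => x.
    by apply: cvgM; [exact: cvg_cst|exact: crh].
  by apply: eq_Rintegral => x _; rewrite mulrBl.
apply: le_trans (le_normr_Rintegral _ i1) _; first exact: measurable_ball.
have -> : 2 * M * ((e *+ 2)^-1 * I e) = M / e * I e.
  by rewrite -[e *+ 2]mulr_natl; field; rewrite gt_eqF.
rewrite -RintegralZl; last 2 first.
  exact: measurable_ball.
  exact: bint (itv_integrable_norm uci).
apply: le_Rintegral => [||| x _]; first exact: measurable_ball.
- exact: integrable_norm i1.
- have ni := itv_integrable_norm uci.
  have : itv_integrable (fun x => `|u x - u c| * (M / e)).
    exact: (@itv_integrableM _ _ (cst (M / e)) `|M / e|).
  by move=> /(bint _ e); apply: eq_integrable => [|x _];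
    [exact: measurable_ball|rewrite /= mulrC].
- by rewrite normrM mulrC ler_wpM2r// rh_le.
Unshelve. all: by end_near. Qed.

(** Outside [c - e, c + e] the smoothed step is 0 or 1. Inside, the integral is bounded by the
    increment of a continuous primitive [H] of |g|, which tends to 0. *)
Lemma approximate_step g (G : R -> R) p q c : itv_integrable g -> continuous G ->
  (forall a b, a <= b -> \int[mu]_(x in `[a, b]) g x = G b - G a) ->
  p < c -> c < q ->
  \int[mu]_(x in `[p, q]) (g x * th e c x) @[e --> 0^'+] --> G q - G c.
Proof.
move=> gi cG GE pc cq.
have [H [cH HE _]] := exists_primitive (itv_integrable_norm gi).
have thb e x : `|th e c x| <= 1.
  by have /andP[t0 t1] := th01 e c x; rewrite ger0_norm.
have mth e : measurable_fun [set: R] (th e c).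
  by apply: continuous_measurable_fun; exact: is_deriv_continuous (@th' e c).
have ghi e := itv_integrableM gi (mth e) (thb e).
pose r e := \int[mu]_(x in `[c - e, c + e]) (g x * th e c x).
have r0 : r e @[e --> 0^'+] --> 0.
  apply/norm_cvg0P; apply: (@squeeze_cvgr _ _ _ _ (cst 0) (fun e => H (c + e) - H (c - e))).
  - near=> e; have e0 : 0 < e by near: e; exact: nbhs_right_gt.
    rewrite /= normr_ge0/= -HE; last by lra.
    apply: le_trans (le_normr_Rintegral _ ((ghi e).2 _ _)) _ => //.
    apply: le_Rintegral => // [||x _].
    + exact: integrable_norm ((ghi e).2 _ _).
    + exact: (itv_integrable_norm gi).2.
    + by rewrite normrM ler_piMr.
  - exact: cvg_cst.
  - by rewrite -[X in _ --> X](subrr (H c)); have [? ?] := cvg_at_right_shift c cH; exact: cvgB.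
have lim : r e + (G q - G (c + e)) @[e --> 0^'+] --> G q - G c.
  rewrite -[X in _ --> X]add0r; apply: cvgD r0 _; apply: cvgB; first exact: cvg_cst.
  by have [] := cvg_at_right_shift c cG.
apply: cvg_trans lim; apply: near_eq_cvg; near=> e.
have e0 : 0 < e by near: e; exact: nbhs_right_gt.
have ec : e < c - p by near: e; apply: nbhs_right_lt; rewrite subr_gt0.
have eq : e < q - c by near: e; apply: nbhs_right_lt; rewrite subr_gt0.
rewrite (@Rintegral_chasles _ _ p (c - e))//; [|lra..].
rewrite (@Rintegral_chasles _ _ (c - e) (c + e))//; [|lra..].
rewrite [X in _ = X + _](_ : _ = 0) ?add0r; last first.
  transitivity (\int[mu]_(x in `[p, c - e]) cst 0 x); last first.
    by rewrite Rintegral_cst// mul0r.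
  by apply: eq_Rintegral => x; rewrite inE/= in_itv/= => /andP[_ xc]; rewrite th0// mulr0.
congr (_ + _); rewrite -GE; last by lra.
by apply: eq_Rintegral => x; rewrite inE/= in_itv/= => /andP[xc _]; rewrite th1// mulr1.
Unshelve. all: by end_near. Qed.

Lemma test_function_step (e a b : R) : 0 < e -> a <= b ->
  test_function (fun x => th e a x - th e b x).
Proof.
move=> e0 ab; split.
  by move=> n; apply: smooth_derive1n; apply: smoothB; exact: smooth_th.
apply: (@subclosed_compact _ _ `[a - e, b + e]).
- exact: closed_closure.
- exact: segment_compact.
- rewrite (closure_id `[a - e, b + e]).1; last exact: interval_closed.
  apply: closure_subset => x /=; rewrite in_itv/=; apply: contra_neqT.
  rewrite negb_and -!ltNge => /orP[] xe.
    by rewrite !th0 ?subrr//; lra.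
  by rewrite !th1 ?subrr//; lra.
Qed.

(** The weak derivative is tested against the smoothed indicator of [a, b], and e tends to 0. *)
Lemma weak_derivative_lebesgue_pt u g (G : R -> R) (a b : R) :
  itv_integrable u -> itv_integrable g -> continuous G ->
  (forall a b, a <= b -> \int[mu]_(x in `[a, b]) g x = G b - G a) ->
  (forall phi, test_function phi -> distr_deriv 1 (distr u) phi = distr g phi) ->
  lebesgue_pt u a -> lebesgue_pt u b -> a < b -> u b - u a = G b - G a.
Proof.
move=> ui gi cG GE ug ua ub ab.
have lim1 : - (\int[mu]_x (u x * rh e a x) - \int[mu]_x (u x * rh e b x))
    @[e --> 0^'+] --> - (u a - u b).
  by apply: cvgN; apply: cvgB; exact: approximate_identity.
(* The interval [a - 1, b + 1] contains the support of the test function once e < 1; the value of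
   [G] at its right end cancels. *)
have lim2 : \int[mu]_(x in `[a - 1, b + 1]) (g x * th e a x) -
    \int[mu]_(x in `[a - 1, b + 1]) (g x * th e b x) @[e --> 0^'+] -->
    (G (b + 1) - G a) - (G (b + 1) - G b).
  by apply: cvgB; apply: approximate_step => //; lra.
suff : - (u a - u b) = (G (b + 1) - G a) - (G (b + 1) - G b) by lra.
apply: (cvg_unique _ lim1) => //; apply: cvg_trans lim2; apply: near_eq_cvg; near=> e.
have e0 : 0 < e by near: e; exact: nbhs_right_gt.
have e1 : e < 1 by near: e; exact: nbhs_right_lt.
have mrh c : measurable_fun [set: R] (rh e c) by apply: continuous_measurable_fun; exact: crh.
have mth c : measurable_fun [set: R] (th e c).
  by apply: continuous_measurable_fun; exact: is_deriv_continuous (@th' e c).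
have thb c x : `|th e c x| <= 1.
  by have /andP[t0 t1] := th01 e c x; rewrite ger0_norm.
have urh c := (itv_integrableM ui (mrh c) (fun x => rh_le c x e0)).2 (a - 1) (b + 1).
have gth c := (itv_integrableM gi (mth c) (thb c)).2 (a - 1) (b + 1).
have out x : ~ `[a - 1, b + 1]%classic x -> x < a - 1 \/ b + 1 < x.
  by move/negP; rewrite in_itv/= negb_and -!ltNge => /orP.
have rhout c x : a <= c -> c <= b -> ~ `[a - 1, b + 1]%classic x -> rh e c x = 0.
  move=> ac cb /out xo; apply: rh0 => // /ball_itv; rewrite /= in_itv/= => /andP[? ?].
  by case: xo; lra.
have := ug _ (test_function_step e0 (ltW ab)).
rewrite /distr_deriv /distr expr1 mulN1r.
have -> : derive1n 1 (fun x => th e a x - th e b x) = fun x => rh e a x - rh e b x.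
  apply/funext => x; rewrite derive1n1 derive1E.
  by have [_ ->] := is_derivB (@th' e a) (@th' e b) x.
rewrite (@Rintegral_support `[a - 1, b + 1]); last first.
  by move=> x xo; rewrite !rhout ?subrr ?mulr0// ltW.
rewrite (@Rintegral_support `[a - 1, b + 1] (fun x => g x * _)); last first.
  by move=> x /out[xo|xo]; [rewrite !th0 ?subrr ?mulr0//; lra|rewrite !th1 ?subrr ?mulr0//; lra].
under eq_Rintegral do rewrite mulrBr.
under [in RHS]eq_Rintegral do rewrite mulrBr.
rewrite !RintegralB// => <-; congr (- (_ - _)).
  by apply/esym/Rintegral_support => x xo; rewrite rhout ?mulr0// ltW.
by apply/esym/Rintegral_support => x xo; rewrite rhout ?mulr0// ltW.
Unshelve. all: by end_near. Qed.

End smooth_step.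

(** Almost every point is a Lebesgue point of [u], and any one of them fixes the constant. *)
Lemma weak_derivative_primitive u g (G : R -> R) : itv_integrable u -> itv_integrable g ->
  continuous G ->
  (forall a b, a <= b -> \int[mu]_(x in `[a, b]) g x = G b - G a) ->
  (forall phi, test_function phi -> distr_deriv 1 (distr u) phi = distr g phi) ->
  exists c, {ae mu, forall x, u x = G x + c}.
Proof.
move=> ui gi cG GE ug.
have [theta [rho [M [th' ths M0 step]]]] := exists_smooth_step.
have ae := lebesgue_differentiation (itv_integrable_locally ui).
have [a ua] := ae_exists ae.
exists (u a - G a); apply: ae_imply ae => x ux.
have key := weak_derivative_lebesgue_pt th' ths step ui gi cG GE ug.
have [xa|ax|->] := ltgtP x a; last by rewrite addrC subrK.
  by have := key _ _ ux ua xa; lra.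
by have := key _ _ ua ux ax; lra.
Qed.

End weak_derivatives.

(** * Regularity of the solutions *)

Section test_functions.
Context {R : realType}.
Local Notation mu := (@lebesgue_measure R).
Local Open Scope classical_set_scope.
Local Open Scope ring_scope.
Implicit Types f g phi : R -> R.

(** Lets the second-order equation be read as a first-order one: up to sign, testing u'' against phi
    is testing the weak derivative of u against the derivative of phi. *)
Lemma test_function_derive phi : test_function phi -> test_function (derive1n 1 phi).
Proof.
move=> [dphi cphi]; split.
  by move=> n x; rewrite /derive1n -iterSr; exact: (dphi n.+1).
apply: subclosed_compact cphi _; first exact: closed_closure.
rewrite [X in _ `<=` X](closure_id _).1; last exact: closed_closure.
apply: closure_subset => x /=; apply: contra_neqP => xK.
have : \forall y \near x, cst 0 y = phi y.
  have oK : open (~` closure [set x | phi x != 0]).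
    by apply: closed_openC; exact: closed_closure.
  apply: filterS (open_nbhs_nbhs (conj oK xK)) => y yK /=.
  by apply/esym; apply: contra_notP yK => /eqP py; exact: subset_closure.
move=> /near_eq_is_derive/(_ (is_derive_cst _ _ _)) h.
by rewrite derive1E; have [_ ->] := h 1.
Qed.

Lemma test_function_continuous phi : test_function phi -> continuous phi.
Proof.
by move=> [dphi _] x; apply/differentiable_continuous/derivable1_diffP; exact: (dphi 0%N x).
Qed.

Lemma test_functionM_integrable f phi : continuous f -> test_function phi ->
  mu.-integrable [set: R] (EFin \o (fun x => f x * phi x)).
Proof.
move=> cf tphi; have [_ cphi] := tphi.
set K := closure _ in cphi.
rewrite (_ : EFin \o _ = (EFin \o (fun x => f x * phi x)) \_ K); last first.
  apply/funext => x; rewrite patchE; case: ifPn => // /negP xK /=.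
  suff -> : phi x = 0 by rewrite mulr0.
  by apply: contrapT => /eqP px; apply: xK; rewrite inE; exact: subset_closure.
rewrite -integrable_mkcond; last exact: compact_measurable.
apply: continuous_compact_integrable => //; apply: continuous_subspaceT => x.
by apply: cvgM; [exact: cf|exact: test_function_continuous].
Qed.

Lemma ae_eq_Rintegral (D : set R) f g : measurable D ->
  measurable_fun [set: R] f -> measurable_fun [set: R] g ->
  {ae mu, forall x, f x = g x} -> \int[mu]_(x in D) f x = \int[mu]_(x in D) g x.
Proof.
move=> mD mf mg fg; congr fine; apply: ae_eq_integral => //.
- by apply/measurable_EFinP; exact: measurable_funS mf.
- by apply/measurable_EFinP; exact: measurable_funS mg.
- by apply: ae_imply fg => x -> _.
Qed.

End test_functions.

(** * Decay from a bounded energy *)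

Section energy_decay.
Context {R : realType}.
Local Open Scope classical_set_scope.
Local Open Scope ring_scope.
Implicit Types f E : R -> R.

(* Beyond A, both E and E - f^2 are nondecreasing: as E is bounded, f^2 cannot
   stay away from 0, nor can it grow again by more than E does. *)
Lemma energy_cvg0 f f' E e (A B : R) : is_deriv f f' -> is_deriv E e ->
  (forall x, 0 <= e x) -> (forall x, E x <= B) ->
  (forall x, A <= x -> f x ^+ 2 + f' x ^+ 2 <= e x) ->
  f x @[x --> +oo] --> (0 : R).
Proof.
move=> ff' Ee e0 EB fe.
have ndE : nondecreasing_fun E by move=> x y; apply: is_deriv_ndecr Ee _ => z _.
have ubE : has_ubound (range E) by exists B => _ [x _ <-].
have cE := nondecreasing_cvgr ndE ubE.
set L := sup _ in cE.
apply/cvgrPdist_lt => d d0.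
(* One half of d^2 bounds f^2 at a well-chosen point, the other half bounds its later growth. *)
have d2 : 0 < d ^+ 2 / 2 by rewrite divr_gt0// exprn_gt0.
have EL x : E x <= L by apply: ub_le_sup; [exists B => _ [y _ <-]|exists x].
have /cvgrPdist_lt/(_ _ d2)[X0 [_ hX]] := cE.
pose X := Num.max A (X0 + 1).
have XA : A <= X by rewrite le_max lexx.
have EX : L - E X < d ^+ 2 / 2.
  have : X0 < X by rewrite lt_max ltrDl ltr01 orbT.
  by move/hX; apply: le_lt_trans; exact: ler_norm.
(* Otherwise [E] would rise by at least d^2 / 2 over [X, X + 1] and exceed its supremum [L]. *)
have [x Xx fx] : exists2 x, X <= x & f x ^+ 2 <= d ^+ 2 / 2.
  apply: contrapT => no.
  have big x : X <= x -> d ^+ 2 / 2 < f x ^+ 2.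
    by move=> Xx; rewrite ltNge; apply/negP => fx; apply: no; exists x.
  have dlin : is_deriv (fun x => E x - d ^+ 2 / 2 * x) (fun x => e x - d ^+ 2 / 2).
    apply: is_deriv_eq; first by apply: is_derivB Ee (is_derivMl _ (fun x => is_derive_id x _)).
    by move=> x; rewrite mulr1.
  have : E X - d ^+ 2 / 2 * X <= E (X + 1) - d ^+ 2 / 2 * (X + 1).
    apply: is_deriv_ndecr dlin _ _; last by rewrite lerDl.
    move=> z /andP[Xz _]; have := big _ Xz; have := fe _ (le_trans XA Xz).
    by have := sqr_ge0 (f' z); lra.
  by have := EL (X + 1); lra.
exists x; split; first exact: num_real.
move=> y xy; rewrite sub0r normrN -ltr_sqr ?nnegrE ?(ltW d0)// real_normK ?num_real//.
have := is_deriv_ndecr (is_derivB Ee (is_deriv_sqr ff')) _ (ltW xy).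
(* From 2 f f' <= f^2 + f'^2 <= e. *)
have h z : x <= z <= y -> 0 <= e z - 2 * f z * f' z.
  move=> /andP[xz _]; have := fe z (le_trans XA (le_trans Xx xz)).
  have := sqr_ge0 (f z - f' z); rewrite sqrrB; lra.
move=> /(_ h); have := EL y; have := ndE _ _ Xx; lra.
Qed.

Lemma energy_decays f f' E e (A B : R) : is_deriv f f' -> is_deriv E e ->
  (forall x, 0 <= e x) -> (forall x, `|E x| <= B) ->
  (forall x, A <= `|x| -> f x ^+ 2 + f' x ^+ 2 <= e x) -> decays f.
Proof.
move=> ff' Ee e0 EB fe; split.
  apply: (energy_cvg0 (A := A) (B := B) ff' Ee e0) => x.
    by apply: le_trans (EB x); exact: ler_norm.
  by move=> Ax; apply: fe; apply: le_trans Ax (ler_norm _).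
apply/cvgNy_compNP.
apply: (energy_cvg0 (A := A) (B := B) (is_deriv_opp ff') (is_derivN (is_deriv_opp Ee))) => x.
- by rewrite opprK.
- by apply: le_trans (EB (- x)); rewrite -normrN; exact: ler_norm.
- move=> Ax; rewrite sqrrN opprK; apply: fe.
  by rewrite normrN; apply: le_trans Ax (ler_norm _).
Qed.

Lemma Lfun2_energy (f F : R -> R) : f \in Lfun (@lebesgue_measure R) 2%:E ->
  continuous F -> {ae @lebesgue_measure R, forall x, f x = F x} ->
  exists E : R -> R, exists B : R,
    is_deriv E (fun x => F x ^+ 2) /\ forall x, `|E x| <= B.
Proof.
move=> f2 cF fF.
have mf : measurable_fun [set: R] f.
  by move: f2; rewrite inE => /andP[]; rewrite inE.
have cF2 : continuous (fun x => F x ^+ 2) by move=> x; apply: cvgM; exact: cF.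
have mF2 : measurable_fun [set: R] (fun x => F x ^+ 2) by exact: continuous_measurable_fun.
have iF2 : (@lebesgue_measure R).-integrable [set: R] (EFin \o (fun x => F x ^+ 2)).
  have /integrableP[_ fi] := Lfun2_integrable_sqr f2.
  apply/integrableP; split; first exact/measurable_EFinP.
  apply: le_lt_trans fi; rewrite le_eqVlt; apply/orP; left; apply/eqP.
  apply: ae_eq_integral => //.
  - by apply/measurable_EFinP; apply: measurableT_comp => //.
  - apply/measurable_EFinP; apply: measurableT_comp => //.
    exact: measurable_funX.
  - by apply: ae_imply fF => x /= -> _.
have [E [_ EE E']] := exists_primitive (continuous_itv_integrable cF2).
set B := \int[@lebesgue_measure R]_x (F x ^+ 2).
have EB a b : a <= b -> `|E b - E a| <= B.
  move=> ab; rewrite -EE// ger0_norm; last by apply: Rintegral_ge0 => x _; exact: sqr_ge0.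
  rewrite Rintegral_mkcond; apply: le_Rintegral => // [|x _].
    rewrite -restrict_EFin -integrable_mkcond//; exact: integrableS iF2.
  by rewrite patchE; case: ifPn => // _; exact: sqr_ge0.
exists (fun x => E x - E 0), B; split.
  apply: is_deriv_eq; first by apply: is_derivB (is_deriv_cst _) => x; exact: E' (cF2 x).
  by move=> x; rewrite subr0.
by move=> x; have [x0|/ltW x0] := leP 0 x; [|rewrite distrC]; exact: EB.
Qed.

End energy_decay.

Section regularity.
Context {R : realType}.
Local Notation mu := (@lebesgue_measure R).
Local Open Scope classical_set_scope.
Local Open Scope ring_scope.

Lemma ae_forall (I : finType) (P : I -> R -> Prop) :
  (forall i, {ae mu, forall x, P i x}) -> {ae mu, forall x, forall i, P i x}.
Proof.
move=> aP.
have aux (s : seq I) : {ae mu, forall x, forall i, i \in s -> P i x}.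
  elim: s => [|i s IH].
    exact: aeW.
  apply: ae_imply (ae_conj (aP i) IH) => x [Pi Ps] j.
  by rewrite in_cons => /predU1P[->//|]; exact: Ps.
by apply: ae_imply (aux (enum I)) => x + i; apply; rewrite mem_enum.
Qed.

Variables (N : nat) (nu : 'I_N -> R) (u : 'I_N -> R -> R).
Hypotheses (uH1 : forall i, H1 (u i)) (sol : system_solution nu u).

(** A bootstrap: [u i] is almost everywhere a primitive [U i] of its weak derivative [g i], hence
    continuous; so the weak derivative [h i] of [g i] is continuous, and [g i] is almost everywhere
    a C^1 function [U' i]. *)
Lemma regular_representative : exists U U' : 'I_N -> R -> R,
  (forall i, {ae mu, forall x, u i x = U i x}) /\
  decaying_system [set: 'I_N]%SET nu U U'.
Proof.
have /choice[g gP] : forall i, exists g, g \in Lfun mu 2%:E /\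
    forall phi, test_function phi -> distr_deriv 1 (distr (u i)) phi = distr g phi.
  by move=> i; have [_ [g g2 gu]] := uH1 i; exists g.
have ui i : itv_integrable (u i) by have [u2 _] := uH1 i; exact: Lfun2_itv_integrable.
have gi i : itv_integrable (g i) by have [g2 _] := gP i; exact: Lfun2_itv_integrable.
have /choice[U UP] : forall i, exists V, [/\ continuous V,
    forall a b, a <= b -> \int[mu]_(x in `[a, b]) g i x = V b - V a &
    {ae mu, forall x, u i x = V x}].
  move=> i; have [G [cG GE _]] := exists_primitive (gi i).
  have [c uc] := weak_derivative_primitive (ui i) (gi i) cG GE (gP i).2.
  exists (fun x => G x + c); split => //.
    by move=> x; apply: cvgD; [exact: cG|exact: cvg_cst].
  by move=> a b ab; rewrite GE//; ring.
have cU i : continuous (U i) by have [] := UP i.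
have uU i : {ae mu, forall x, u i x = U i x} by have [] := UP i.
pose V x := \sum_(j < N) U j x ^+ 2.
have cV : continuous V.
  rewrite (_ : V = \sum_(j < N) (fun x => U j x ^+ 2)); last first.
    by apply/funext => x; rewrite fct_sumE.
  apply: (@big_ind _ (fun f : R -> R => continuous f)) => [|f1 f2 c1 c2|j _] x.
  - exact: cvg_cst.
  - by apply: cvgD; [exact: c1|exact: c2].
  - by apply: cvgM; exact: cU.
pose h i x := - (2 * V x + nu i) * U i x.
have cnl i : continuous (fun x => 2 * V x * U i x).
  move=> x; apply: cvgM; last exact: cU.
  by apply: cvgM; [exact: cvg_cst|exact: cV].
have clin i : continuous (fun x => nu i * U i x).
  by move=> x; apply: cvgM; [exact: cvg_cst|exact: cU].
have ch i : continuous (h i).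
  rewrite (_ : h i = fun x => - (2 * V x * U i x) - nu i * U i x); last first.
    by apply/funext => x; rewrite /h; ring.
  by move=> x; apply: cvgB; [apply: cvgN; exact: cnl|exact: clin].
(* With the continuous [U] in place of [u], each term is integrable against phi and the integral may
   be split. *)
have gh i phi : test_function phi -> distr_deriv 1 (distr (g i)) phi = distr (h i) phi.
  move=> tphi.
  have mphi : measurable_fun [set: R] phi.
    by apply: continuous_measurable_fun; exact: test_function_continuous.
  have aU : {ae mu, forall x, forall j, u j x = U j x} by exact: ae_forall uU.
  have e1 : distr (fun x => 2 * (\sum_(j < N) u j x ^+ 2) * u i x) phi =
      distr (fun x => 2 * V x * U i x) phi.
    apply: ae_eq_Rintegral => //.
    - apply: measurable_funM => //; apply: measurable_funM; last exact: (ui i).1.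
      apply: measurable_funM => //; apply: measurable_sum => j.
      by apply: measurable_funX; exact: (ui j).1.
    - by apply: measurable_funM => //; exact: continuous_measurable_fun.
    - apply: ae_imply aU => x ux; rewrite ux /V; congr (2 * _ * _ * _).
      by apply: eq_bigr => j _; rewrite ux.
  have e2 : distr (fun x => nu i * u i x) phi = distr (fun x => nu i * U i x) phi.
    apply: ae_eq_Rintegral => //.
    - apply: measurable_funM => //; apply: measurable_funM => //; exact: (ui i).1.
    - by apply: measurable_funM => //; exact: continuous_measurable_fun.
    - by apply: ae_imply aU => x ux; rewrite ux.
  have e3 : distr (h i) phi =
      - distr (fun x => 2 * V x * U i x) phi - distr (fun x => nu i * U i x) phi.
    have i1 := test_functionM_integrable (cnl i) tphi.
    have i2 := test_functionM_integrable (clin i) tphi.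
    rewrite /distr -opprD -RintegralD// -[RHS]mulN1r -RintegralZl//; last first.
      exact: (@integrableD _ _ _ mu _ _ _ _ i1 i2).
    by apply: eq_Rintegral => x _; rewrite /h; ring.
  have s1 := sol i tphi; rewrite e1 e2 in s1.
  have s2 : (-1) ^+ 1 * distr (u i) (derive1n 2 phi) = distr (g i) (derive1n 1 phi).
    exact: (gP i).2 _ (test_function_derive tphi).
  rewrite e3; rewrite /distr_deriv -s2; rewrite /distr_deriv in s1.
  move: (distr _ _) (distr _ _) (distr _ _) s1 => T0 T1 T2.
  rewrite sqrrN expr1n mul1r expr1 !mulN1r opprK => s1.
  by apply/eqP; rewrite -subr_eq0 -s1; apply/eqP; ring.
have /choice[U' U'P] : forall i, exists G, [/\ continuous G, is_deriv G (h i) &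
    {ae mu, forall x, g i x = G x}].
  move=> i; have hi := continuous_itv_integrable (ch i).
  have [G [cG GE G']] := exists_primitive hi.
  have [c uc] := weak_derivative_primitive (gi i) hi cG GE (gh i).
  exists (fun x => G x + c); split => //.
    by move=> x; apply: cvgD; [exact: cG|exact: cvg_cst].
  apply: is_deriv_eq; first by apply: is_derivD (is_deriv_cst c) => x; exact: G' (ch i x).
  by move=> x; rewrite addr0.
(* The increments of [U i] are integrals of [g i], hence of the continuous [U' i]. *)
have UU' i : is_deriv (U i) (U' i).
  have [cU' _ gU'] := U'P i.
  have [G [_ GE G']] := exists_primitive (continuous_itv_integrable cU').
  have GU a b : a <= b -> U i b - U i a = G b - G a.
    move=> ab; have [_ <- // _] := UP i; rewrite -GE//.
    apply: ae_eq_Rintegral => //; first exact: (gi i).1.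
    exact: continuous_measurable_fun.
  rewrite (_ : U i = fun x => G x + (U i 0 - G 0)).
    apply: is_deriv_eq; first by apply: is_derivD (is_deriv_cst _) => x; exact: G' (cU' x).
    by move=> x; rewrite addr0.
  apply/funext => x; have [x0|/ltW x0] := leP 0 x; have := GU _ _ x0; lra.
have [E [e [B [E' e0 EB UE]]]] : exists E e, exists B : R, [/\ is_deriv E e,
    forall x, 0 <= e x, forall x, `|E x| <= B &
    forall i x, U i x ^+ 2 + U' i x ^+ 2 <= e x].
  have /choice[E1 /choice[B1 E1P]] i : exists E B, is_deriv E (fun x => U i x ^+ 2) /\
      forall x, `|E x| <= B.
    by have [u2 _] := uH1 i; exact: Lfun2_energy u2 (cU i) (uU i).
  have /choice[E2 /choice[B2 E2P]] i : exists E B, is_deriv E (fun x => U' i x ^+ 2) /\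
      forall x, `|E x| <= B.
    by have [g2 _] := gP i; have [cU' _ gU'] := U'P i; exact: Lfun2_energy g2 cU' gU'.
  exists (fun x => \sum_(i < N) (E1 i x + E2 i x)).
  exists (fun x => \sum_(i < N) (U i x ^+ 2 + U' i x ^+ 2)), (\sum_(i < N) (B1 i + B2 i)).
  split.
  - by apply: is_deriv_sum => i _; apply: is_derivD; [have [] := E1P i|have [] := E2P i].
  - by move=> x; apply: sumr_ge0 => i _; rewrite addr_ge0 ?sqr_ge0.
  - move=> x; apply: le_trans (ler_norm_sum _ _ _) _; apply: ler_sum => i _.
    apply: le_trans (ler_normD _ _) _; apply: lerD; first exact: (E1P i).2.
    exact: (E2P i).2.
  - move=> i x; rewrite (bigD1 i)//= lerDl.
    by apply: sumr_ge0 => j _; rewrite addr_ge0 ?sqr_ge0.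
have dU i : decays (U i).
  by apply: (energy_decays (A := 0) (UU' i) E' e0 EB) => x _; exact: UE.
have dV : decays V by apply: decays_sum => i _; exact: decays_sqr.
exists U, U'; split => // i _.
have [cU' hU' _] := U'P i; split => //.
  apply: is_deriv_eq hU' _ => x; rewrite /h /V; congr (- (2 * _ + _) * _).
  by apply: eq_bigl => j; rewrite finset.in_setT.
(* Where V <= 1, |h i| <= (2 + |nu i|) |U i|, so U_i'^2 + U_i''^2 is at most C times the energy
   density. *)
pose C := 1 + (2 + `|nu i|) ^+ 2.
have [A VA] : exists A, forall x, A <= `|x| -> V x <= 1.
  have [/cvgrPdist_le/(_ _ ltr01)[A1 [_ h1]] /cvgrPdist_le/(_ _ ltr01)[A2 [_ h2]]] := dV.
  exists (`|A1| + `|A2| + 1) => x Ax.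
  have n1 := ler_norm A1; have n2 := ler_norm (- A2); rewrite normrN in n2.
  have p1 := normr_ge0 A1; have p2 := normr_ge0 A2.
  suff : `|0 - V x| <= 1 by rewrite sub0r normrN; apply: le_trans; exact: ler_norm.
  have [x0|x0] := leP 0 x.
    by apply: h1; move: Ax; rewrite (ger0_norm x0); lra.
  by apply: h2; move: Ax; rewrite (ltr0_norm x0); lra.
apply: (energy_decays (A := A) (E := fun x => C * E x) (e := fun x => C * e x)
   (B := C * B) hU') => [|x|x|x Ax].
- exact: is_derivMl.
- by rewrite mulr_ge0// /C addr_ge0 ?sqr_ge0.
- rewrite normrM ger0_norm ?ler_wpM2l// /C addr_ge0 ?sqr_ge0//.
- have V0 : 0 <= V x by apply: sumr_ge0 => j _; exact: sqr_ge0.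
  apply: (@le_trans _ _ (C * (U i x ^+ 2 + U' i x ^+ 2))); last first.
    by rewrite ler_wpM2l// /C addr_ge0 ?sqr_ge0.
  have : h i x ^+ 2 <= (2 + `|nu i|) ^+ 2 * U i x ^+ 2.
    rewrite /h exprMn ler_wpM2r ?sqr_ge0// sqrrN.
    rewrite -[X in X <= _]real_normK ?num_real// lerXn2r ?nnegrE ?addr_ge0//.
    apply: le_trans (ler_normD _ _) _; rewrite lerD2r ger0_norm; last by lra.
    by have := VA _ Ax; lra.
  rewrite /C; have := sqr_ge0 (U i x); have := sqr_ge0 (2 + `|nu i|).
  have := sqr_ge0 (U' i x); nra.
Qed.

End regularity.

(** * From primitives to integrals *)

Section total_mass.
Context {R : realType}.
Local Notation mu := (@lebesgue_measure R).
Local Open Scope classical_set_scope.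
Local Open Scope ring_scope.

(** The line is split at 0 and the left half reflected; the two halves contribute l + G 0 and l - G
    0. *)
Lemma integral_primitive_pm (f : R -> R) (l : R) : (forall x, 0 <= f x) ->
  continuous f -> primitive_pm f l -> (\int[mu]_x (f x)%:E)%E = (2 * l)%:E.
Proof.
move=> f0 cf [G G' [Gp Gm]].
have half (F g : R -> R) (m : R) : (forall x, 0 <= g x) -> continuous g ->
    is_deriv F g -> F x @[x --> +oo] --> m ->
    (\int[mu]_(x in `[0%R, +oo[) (g x)%:E)%E = (m - F 0)%:E.
  move=> g0 cg F' Fm; rewrite EFinB; apply: ge0_continuous_FTC2y => //.
  - exact: continuous_subspaceT.
  - by move=> x _; have [] := F' x.
  - by apply: cvg_at_right_filter; exact: is_deriv_continuous F' 0.
  - by move=> x _; rewrite derive1E; have [_ ->] := F' x.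
have mf : measurable_fun [set: R] (EFin \o f).
  by apply/measurable_EFinP; exact: continuous_measurable_fun.
have -> : [set: R] = `]-oo, 0]%classic `|` `]0, +oo[%classic.
  by rewrite -itv_bndbnd_setU// set_itvNyy.
rewrite ge0_integral_setU//=.
- have := @ge0_integration_by_substitutionNy R f 0; rewrite oppr0 => ->; last 2 first.
    exact: continuous_subspaceT.
    by move=> x _; exact: f0.
  rewrite integral_itv_obnd_cbnd; last exact: measurable_funTS.
  rewrite (half G f l f0 cf G' Gp).
  have Gm' : - G (- x) @[x --> +oo] --> l.
    by rewrite -[l]opprK; apply: cvgN; move/cvgNy_compNP : Gm.
  rewrite (half (fun x => - G (- x)) (fun x => f (- x)) l) //.
  + by rewrite -EFinD oppr0 opprK; congr EFin; ring.
  + by move=> x; apply: (@cvg_comp _ _ _ -%R f _ (nbhs (- x))); [exact: cvgN|exact: cf].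
  + by apply: is_deriv_eq; [exact: is_derivN (is_deriv_opp G')|move=> x; rewrite opprK].
- exact: measurable_funTS.
- by move=> x _; rewrite lee_fin.
- apply/disj_setPS => x [] /=; rewrite !in_itv/= => x0; rewrite andbT ltNge x0.
  by [].
Qed.

End total_mass.

Section blocks.
Variables (N K : nat) (k : 'I_K -> nat).
Hypothesis kN : (\sum_(a < K) k a)%N = N.

(** The block of [i] is m, where m + 1 is the least n with [i < offset k n]: the value 0 is excluded
    because [offset k 0] is 0, and n <= K because the total is [N]. *)
Lemma mem_block_exists (i : 'I_N) : exists a : 'I_K, i \in block N k a.
Proof.
have ex : exists n, (i < offset k n)%N.
  by exists K; rewrite /offset (eq_bigl xpredT) ?kN// => b; rewrite ltn_ord.
case: (ex_minnP ex) => -[|m] im mmin.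
  by move: im; rewrite /offset big_pred0.
have mK : (m < K)%N.
  apply/negPn/negP; rewrite -leqNgt => Km.
  have : (i < offset k m)%N.
    rewrite /offset (eq_bigl xpredT) ?kN// => b.
    by rewrite (leq_trans (ltn_ord b)).
  by move/mmin; rewrite ltnn.
exists (Ordinal mK); rewrite inE/= im andbT leqNgt; apply/negP => /mmin.
by rewrite ltnn.
Qed.

End blocks.

Theorem theorem1p5 (R : realType) (N K : nat) (k : 'I_K -> nat)
    (mu : 'I_K -> R) (nu : 'I_N -> R) (u : 'I_N -> R -> R)
    (hN : (2 <= N)%N)
    (hk : forall a : 'I_K, (1 <= k a)%N)
    (hkN : (\sum_(a < K) k a)%N = N)
    (hmu_lt : forall a b : 'I_K, (a < b)%N -> mu a < mu b)
    (hmu_neg : forall a : 'I_K, mu a < 0)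
    (hnu : forall (a : 'I_K) (i : 'I_N), i \in block N k a -> nu i = mu a)
    (hH1 : forall i : 'I_N, H1 (u i))
    (hsol : system_solution nu u)
    (hnz : forall a : 'I_K,
       ~ {ae @lebesgue_measure R, forall x : R, \sum_(i in block N k a) u i x ^+ 2 = 0}) :
  forall a : 'I_K,
    (\int[@lebesgue_measure R]_x (\sum_(i in block N k a) u i x ^+ 2)%:E)%E
      = (2 * Num.sqrt `|mu a|)%:E
    /\ 0 < 2 * Num.sqrt `|mu a|.
Proof.
move=> a; split; last by rewrite mulr_gt0// sqrtr_gt0 normr_gt0 lt_eqF.
have nu_lt0 i : nu i < 0.
  by have [b ib] := mem_block_exists hkN i; rewrite (hnu b).
have mu_inj b : mu b = mu a -> b = a.
  move=> mab; apply/val_inj; apply/eqP; case: (ltngtP b a) => // /hmu_lt.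
    by rewrite mab ltxx.
  by rewrite mab ltxx.
(* The values [mu] are distinct, so a block is a level set of [nu], the form in which
   [block_primitive] sees it. *)
have blockE i : (i \in block N k a) = (nu i == mu a).
  apply/idP/eqP => [|ia]; first exact: hnu.
  have [b ib] := mem_block_exists hkN i.
  by rewrite -(mu_inj b)// -ia (hnu b).
have [U [U' [uU sys]]] := regular_representative hH1 hsol.
have aU : {ae @lebesgue_measure R, forall x, forall i, u i x = U i x} by exact: ae_forall uU.
(* Otherwise every [U i] of the block would be identically 0 and the block sum 0 almost everywhere,
   against [hnz]. *)
have [i ia Ui] : exists2 i, i \in block N k a & exists x, U i x != 0.
  apply: contrapT => no; apply: (hnz a); apply: ae_imply aU => x ux.
  rewrite big1// => i ia; rewrite ux; apply/eqP; rewrite sqrf_eq0.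
  by apply: contrapT => /negP Ux; apply: no; exists i => //; exists x.
have prim := block_primitive sys (fun j _ => nu_lt0 j) (finset.in_setT i) Ui.
rewrite (hnu a i ia) in prim.
rewrite (ltr0_norm (hmu_neg a)) -(integral_primitive_pm _ _ prim).
- apply: ae_eq_integral => //.
  + apply/measurable_EFinP; under eq_fun do rewrite -big_filter.
    apply: measurable_sum => j; apply: measurable_funX.
    have [u2 _] := hH1 j; exact: (Lfun2_itv_integrable u2).1.
  + apply/measurable_EFinP; under eq_fun do rewrite -big_filter.
    apply: measurable_sum => j; apply: measurable_funX.
    have [dU _ _ _] := sys j (finset.in_setT j).
    by apply: continuous_measurable_fun; exact: is_deriv_continuous dU.
  + apply: ae_imply aU => x ux _; congr EFin; apply: eq_big => [j|j _]; last by rewrite ux.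
    by rewrite blockE finset.in_setT.
- by move=> x; apply: sumr_ge0 => j _; exact: sqr_ge0.
- apply: (@is_deriv_continuous _ _
    (fun x => \sum_(j in [set: 'I_N]%SET | nu j == mu a) 2 * U j x * U' j x)).
  apply: is_deriv_sum => j _; apply: is_deriv_sqr.
  by have [] := sys j (finset.in_setT j).
Qed.
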